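(* Let $\delta\in S^4_{\theta,\mathrm{loc}}$ be a hermitian, regular (i.e. not a zero divisor) and central element such that $\partial_a\delta=2\alpha_a\delta$ for $a=1,2,3,4$, where $\alpha_a\in S^4_{\theta,\mathrm{loc}}$ and $\alpha_a^*=\alpha_a$. Then there exists a unique connection $\nabla$ such that $(M,h^\delta,\mathfrak g_\varphi,\nabla)$ is a pseudo-Riemannian calculus over $S^4_{\theta,\mathrm{loc}}$, and, writing $\nabla_a=\nabla_{\partial_a}$, $\nabla$ is given by \begin{align*} \nabla_1E_1&=E_1\alpha_1-E_2\alpha_2|Z|^2|W|^{-2}-E_3(\alpha_3|W|^{-2}+1)(1-T^2)-E_4(\alpha_4+T)|Z|^2(1-T^2)\\ \nabla_1E_2&=\nabla_2E_1=E_1\alpha_2+E_2\alpha_1\\ \nabla_1E_3&=\nabla_3E_1=E_1(\alpha_3+|W|^2)+E_3\alpha_1\\ \nabla_1E_4&=E_1(\alpha_4+T)+E_4\alpha_1\\ \nabla_4E_1&=E_1(\alpha_4+3T)+E_4\alpha_1\\ \nabla_2E_2&=-E_1\alpha_1|W|^2|Z|^{-2}+E_2\alpha_2-E_3(\alpha_3|Z|^{-2}-1)(1-T^2)-E_4(\alpha_4+T)|W|^2(1-T^2)\\ \nabla_2E_3&=\nabla_3E_2=E_2(\alpha_3-|Z|^2)+E_3\alpha_2\\ \nabla_2E_4&=E_2(\alpha_4+T)+E_4\alpha_2\\ \nabla_4E_2&=E_2(\alpha_4+3T)+E_4\alpha_2\\ \nabla_3E_3&=-E_1\alpha_1|W|^2(1-T^2)^{-1}-E_2\alpha_2|Z|^2(1-T^2)^{-1}+E_3(\alpha_3+|W|^2-|Z|^2)-E_4(\alpha_4+T)|Z|^2|W|^2\\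 \nabla_3E_4&=E_3(\alpha_4+T)+E_4\alpha_3\\ \nabla_4E_3&=E_3(\alpha_4+3T)+E_4\alpha_3\\ \nabla_4E_4&=-E_1\alpha_1|Z|^{-2}(1-T^2)^{-1}-E_2\alpha_2|W|^{-2}(1-T^2)^{-1}-E_3\alpha_3|Z|^{-2}|W|^{-2}+E_4(\alpha_4+T), \end{align*} and $\nabla_{\partial_i^{(n)}}E_a=(\nabla_iE_a)T^n$ for $i=1,2,3$, $a=1,2,3,4$ and all $n\in\{0,1,2,\dots\}$.
   Context: Algebra. Let $\theta\in[0,1)$ and $q=e^{i2\pi\theta}$. $S^4_\theta$ is the unital $\ast$-algebra over $\mathbb{C}$ generated by $Z,W,T$ with relations $WZ=qZW$, $W^*Z=\bar q ZW^*$, $ZZ^*+WW^*+T^2=1$, $T^*=T$, $[T,Z]=[T,W]=[W,W^*]=[Z,Z^*]=0$. The elements $|Z|^2:=ZZ^*$, $|W|^2:=WW^*$ and $T$ are central. Put $X^1=\frac12(Z+Z^* )$, $X^2=\frac1{2i}(Z-Z^* )$, $X^3=\frac12(W+W^* )$, $X^4=\frac1{2i}(W-W^* )$, $X^5=T$. $S^4_{\theta,\mathrm{loc}}$ is the localization of $S^4_\theta$ at the multiplicative set generated by the central elements $1,|Z|^2,|W|^2,1-T^2,1+T^2$. Derivations. A derivation $d$ is hermitian if $d(a^* )=d(a)^*$. Let $\tilde\partial_1,\dots,\tilde\partial_4$ be the hermitian derivations with $\tilde\partial_1Z=iZ,\ \tilde\partial_1W=0,\ \tilde\partial_1T=0$;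 $\tilde\partial_2Z=0,\ \tilde\partial_2W=iW,\ \tilde\partial_2T=0$; $\tilde\partial_3Z=Z|W|^2,\ \tilde\partial_3W=-W|Z|^2,\ \tilde\partial_3T=0$; $\tilde\partial_4Z=ZT,\ \tilde\partial_4W=WT,\ \tilde\partial_4T=T^2-1$ (extended to $S^4_{\theta,\mathrm{loc}}$). For $n\ge0$ set $\partial^{(n)}_1=T^n(1-T^2)\tilde\partial_1$, $\partial^{(n)}_2=T^n(1-T^2)\tilde\partial_2$, $\partial^{(n)}_3=T^n\tilde\partial_3$, $\partial_i=\partial_i^{(0)}$ ($i=1,2,3$), $\partial_4=\tilde\partial_4$. Let $\mathfrak g$ be the real Lie algebra spanned by all $\partial^{(n)}_1,\partial^{(n)}_2,\partial^{(n)}_3,\partial_4$. Module and metric. $M$ is the right submodule of $(S^4_{\theta,\mathrm{loc}})^5$ generated by (and free on) $E_1=(-X^2(1-T^2),X^1(1-T^2),0,0,0)$, $E_2=(0,0,-X^4(1-T^2),X^3(1-T^2),0)$, $E_3=(X^1|W|^2,X^2|W|^2,-X^3|Z|^2,-X^4|Z|^2,0)$, $E_4=(X^1T,X^2T,X^3T,X^4T,T^2-1)$. For $U=\sum_aE_aU^a$, $V=\sum_bE_bV^b$, $h(U,V)=\sum_{a,b=1}^4(U^a)^*h_{ab}V^b$ with $h_{ab}=\sum_{i=1}^5(E^i_a)^*E^i_b$, i.e. $(h_{ab})=\mathrm{diag}\big(|Z|^2(1-T^2)^2,\ |W|^2(1-T^2)^2,\ |Z|^2|W|^2(1-T^2),\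 1-T^2\big)$, and $h^\delta=\delta h$. The $\mathbb{R}$-linear map $\varphi:\mathfrak g\to M$ is $\varphi(\partial_i^{(n)})=E_iT^n$ ($i=1,2,3$), $\varphi(\partial_4)=E_4$, and $\mathfrak g_\varphi=(\mathfrak g,\varphi)$. Pseudo-Riemannian calculus. Let $\mathcal A$ be a unital $\ast$-algebra and $M$ a right $\mathcal A$-module. A hermitian form is a map $h:M\times M\to\mathcal A$ with $h(U,V+W)=h(U,V)+h(U,W)$, $h(U,Va)=h(U,V)a$, $h(U,V)^*=h(V,U)$; it is a metric if it is non-degenerate ($h(U,V)=0$ for all $V$ implies $U=0$). $(M,h,\mathfrak g_\varphi)$, with $h$ a metric, $\mathfrak g$ a real Lie algebra of hermitian derivations of $\mathcal A$ and $\varphi:\mathfrak g\to M$ $\mathbb R$-linear, is a real metric calculus if $M_\varphi=\varphi(\mathfrak g)$ generates $M$ as an $\mathcal A$-module and $h(E,E')^*=h(E,E')$ for all $E,E'\in M_\varphi$. An affine connection on $(M,\mathfrak g)$ is a map $\nabla:\mathfrak g\times M\to M$, additive in $M$, $\mathbb{R}$-linear in $\mathfrak g$, with $\nabla_d(Ua)=(\nabla_dU)a+U\,d(a)$. $(M,h,\mathfrak g_\varphi,\nabla)$ is a pseudo-Riemannian calculus if $(M,h,\mathfrak g_\varphi)$ is a real metric calculus and, for all $d,d_1,d_2\in\mathfrak g$, $E,E'\in M_\varphi$, $U,V\in M$: $h(\nabla_dE,E')=h(\nabla_dE,E')^*$; $d(h(U,V))=h(\nabla_dU,V)+h(U,\nabla_dV)$;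 and $\nabla_{d_1}\varphi(d_2)-\nabla_{d_2}\varphi(d_1)-\varphi([d_1,d_2])=0$. *)

(* Defs.v *)
From HB Require Import structures.
From mathcomp Require Import all_boot all_order all_algebra.
From mathcomp Require Import generic_quotient complex.
From mathcomp Require Import all_classical all_reals trigo.
From mathcomp Require Import ring.

Set Implicit Arguments.
Unset Strict Implicit.
Unset Printing Implicit Defensive.

Import Order.TTheory GRing.Theory Num.Theory.

Local Open Scope classical_set_scope.
Local Open Scope ring_scope.
Local Open Scope complex_scope.
Local Open Scope quotient_scope.

HB.mixin Record isStarAlgebra (R : realType) A of GRing.Algebra R[i] A := {
  star : A -> A;
  starK : involutive star;
  starD : {morph star : a b / a + b};
  starM : forall a b, star (a * b) = star b * star a;
  starZ : forall (c : R[i]) a, star (c *: a) = c^*%C *: star a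
}.

#[short(type="starAlgType")]
HB.structure Definition StarAlgebra (R : realType) :=
  {A of GRing.Algebra R[i] A & isStarAlgebra R A}.

#[short(type="unitStarAlgType")]
HB.structure Definition UnitStarAlgebra (R : realType) :=
  {A of StarAlgebra R A & GRing.UnitRing A}.

Section StarTheory.
Variables (R : realType) (A : starAlgType R).
Implicit Types a b : A.

Lemma star1 : star (1 : A) = 1.
Proof. by rewrite -[LHS]mul1r -{1}[1](@starK _ A) -starM mul1r starK. Qed.

Lemma star0 : star (0 : A) = 0.
Proof. by apply: (addIr (star 0)); rewrite -starD !add0r. Qed.

Lemma starN a : star (- a) = - star a.
Proof. by apply: (addrI (star a)); rewrite -starD !subrr star0. Qed.

End StarTheory.

Record central_mset (R : realType) (A : starAlgType R) := CentralMset {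
  mset_pred :> A -> Prop;
  mset1 : mset_pred 1;
  msetM : forall s t, mset_pred s -> mset_pred t -> mset_pred (s * t);
  mset_central : forall s, mset_pred s -> forall a, s * a = a * s;
  mset_herm : forall s, mset_pred s -> star s = s;
  mset_neq0 : ~ mset_pred 0
}.

Section Localization.
Variables (R : realType) (A : starAlgType R) (S : central_mset A).

Definition den := {s : A | S s}.
HB.instance Definition _ := gen_eqMixin den.
HB.instance Definition _ := gen_choiceMixin den.

Definition mkden s (Ss : S s) : den := exist _ s Ss.
Definition den1 : den := mkden (mset1 S).
Definition denM (s t : den) : den := mkden (msetM (svalP s) (svalP t)).

Definition loc_rel (x y : A * den) : bool :=
  `[< exists u : den, sval u * (sval y.2 * x.1) = sval u * (sval x.2 * y.1) >].

Let pull (s : den) a b : a * (sval s * b) = sval s * (a * b).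
Proof. by rewrite !mulrA (mset_central (svalP s)). Qed.

Ltac lperm := rewrite /= -?mulrA;
  repeat first [ reflexivity
  | match goal with |- (sval ?x * _)%R = _ =>
      do ?rewrite [in RHS](pull x); congr (_ * _) end ].

Fact loc_rel_equiv : equiv_class_of loc_rel.
Proof.
split.
- by move=> x; apply/asboolP; exists den1.
- by move=> x y; apply/asboolP/asboolP => -[u e]; exists u.
- move=> [b t] [a s] [c r] /asboolP[u /= e] /asboolP[v /= f].
  apply/asboolP; exists (denM (denM u v) t).
  transitivity (sval v * (sval r * (sval u * (sval t * a)))); first by lperm.
  rewrite e; transitivity (sval u * (sval s * (sval v * (sval r * b)))).
    by lperm.
  by rewrite f; lperm.
Qed.

Canonical loc_equiv := EquivRelPack loc_rel_equiv.

Definition loc := {eq_quot loc_equiv}.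
HB.instance Definition _ := Choice.on loc.

Definition frac (a : A) (s : den) : loc := \pi_loc (a, s).

Lemma fracP a s b t :
  frac a s = frac b t <->
  exists u : den, sval u * (sval t * a) = sval u * (sval s * b).
Proof.
split=> [/eqP|e]; first by rewrite eqmodE => /asboolP.
by apply/eqP; rewrite eqmodE; apply/asboolP.
Qed.

Lemma frac_ext a s b t : sval t * a = sval s * b -> frac a s = frac b t.
Proof. by move=> e; apply/fracP; exists den1; rewrite e. Qed.

Lemma fracW (P : loc -> Prop) : (forall a s, P (frac a s)) -> forall x, P x.
Proof. by move=> Pf x; rewrite -[x]reprK; case: (repr x). Qed.

Definition loc_lift1 (f : A -> A) (x : loc) : loc :=
  frac (f (repr x).1) (repr x).2.
Definition loc_add (x y : loc) : loc :=
  frac (sval (repr y).2 * (repr x).1 + sval (repr x).2 * (repr y).1)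
       (denM (repr x).2 (repr y).2).
Definition loc_mul (x y : loc) : loc :=
  frac ((repr x).1 * (repr y).1) (denM (repr x).2 (repr y).2).

Lemma repr_frac a s : exists u : den,
  sval u * (sval s * (repr (frac a s)).1) =
  sval u * (sval (repr (frac a s)).2 * a).
Proof.
have /fracP : frac (repr (frac a s)).1 (repr (frac a s)).2 = frac a s.
  by rewrite /frac -surjective_pairing reprK.
by [].
Qed.

Lemma loc_lift1E f : {morph f : a b / a + b} ->
    (forall (s : den) a, f (sval s * a) = sval s * f a) ->
  forall a s, loc_lift1 f (frac a s) = frac (f a) s.
Proof.
move=> _ fs a s; have [u e] := repr_frac a s; apply/fracP.
by exists u; rewrite -!fs e.
Qed.

Lemma loc_addE a s b t :
  loc_add (frac a s) (frac b t) = frac (sval t * a + sval s * b) (denM s t).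
Proof.
rewrite /loc_add; have [u] := repr_frac a s; have [v] := repr_frac b t.
move: (repr _) (repr _) => [a' s'] [b' t'] /= f e.
apply/fracP; exists (denM u v); rewrite !mulrDr; congr (_ + _).
  transitivity (sval v * (sval t * (sval t' * (sval u * (sval s * a'))))).
    by lperm.
  by rewrite e; lperm.
transitivity (sval u * (sval s * (sval s' * (sval v * (sval t * b'))))).
  by lperm.
by rewrite f; lperm.
Qed.

Lemma loc_mulE a s b t :
  loc_mul (frac a s) (frac b t) = frac (a * b) (denM s t).
Proof.
rewrite /loc_mul; have [u] := repr_frac a s; have [v] := repr_frac b t.
move: (repr _) (repr _) => [a' s'] [b' t'] /= f e.
apply/fracP; exists (denM u v).
transitivity ((sval u * (sval s * a')) * (sval v * (sval t * b'))).
  by rewrite (pull v) (pull t); lperm.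
by rewrite e f (pull v) (pull t'); lperm.
Qed.

Lemma frac_common a s b t : exists a' b' (r : den),
  frac a s = frac a' r /\ frac b t = frac b' r.
Proof.
exists (sval t * a), (sval s * b), (denM s t).
by split; apply: frac_ext; lperm.
Qed.

Lemma loc_addE1 a b s : loc_add (frac a s) (frac b s) = frac (a + b) s.
Proof. by rewrite loc_addE; apply: frac_ext; rewrite -mulrDr; lperm. Qed.

Lemma denMC s t : denM s t = denM t s.
Proof. by apply: eq_exist; rewrite /= (mset_central (svalP s)). Qed.

Lemma denMA r s t : denM r (denM s t) = denM (denM r s) t.
Proof. by apply: eq_exist; rewrite /= mulrA. Qed.

Lemma denM1 s : denM den1 s = s.
Proof. by case: s => s Ss; apply: eq_exist; rewrite /= mul1r. Qed.

Fact loc_addC : commutative loc_add.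
Proof.
elim/fracW=> a s; elim/fracW=> b t.
by have [? [? [r [-> ->]]]] := frac_common a s b t; rewrite !loc_addE1 addrC.
Qed.

Fact loc_addA : associative loc_add.
Proof.
elim/fracW=> a s; elim/fracW=> b t; elim/fracW=> c r.
rewrite !loc_addE -denMA; congr (frac _ _).
by rewrite !mulrDr /= addrA; congr (_ + _ + _); lperm.
Qed.

Fact loc_add0 : left_id (frac 0 den1) loc_add.
Proof. by elim/fracW=> a s; rewrite loc_addE mulr0 add0r mul1r denM1. Qed.

Lemma loc_oppE a s : loc_lift1 -%R (frac a s) = frac (- a) s.
Proof. by apply: loc_lift1E => [? ?|? ?]; rewrite ?opprD // mulrN. Qed.

Fact loc_addN : left_inverse (frac 0 den1) (loc_lift1 -%R) loc_add.
Proof.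
elim/fracW=> a s; rewrite loc_oppE loc_addE1 addNr.
by apply: frac_ext; rewrite !mulr0.
Qed.

HB.instance Definition _ :=
  GRing.isZmodule.Build loc loc_addA loc_addC loc_add0 loc_addN.

Lemma fracD a b s : frac a s + frac b s = frac (a + b) s.
Proof. exact: loc_addE1. Qed.

Lemma frac0 s : frac 0 s = 0.
Proof. by apply: frac_ext; rewrite !mulr0. Qed.

Lemma fracN a s : - frac a s = frac (- a) s.
Proof. exact: loc_oppE. Qed.

Fact loc_mulA : associative loc_mul.
Proof.
elim/fracW=> a s; elim/fracW=> b t; elim/fracW=> c r.
by rewrite !loc_mulE mulrA denMA.
Qed.

Fact loc_mul1 : left_id (frac 1 den1) loc_mul.
Proof. by elim/fracW=> a s; rewrite loc_mulE mul1r denM1. Qed.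

Fact loc_1mul : right_id (frac 1 den1) loc_mul.
Proof. by elim/fracW=> a s; rewrite loc_mulE mulr1 denMC denM1. Qed.

Fact loc_mulDl : left_distributive loc_mul +%R.
Proof.
elim/fracW=> a s; elim/fracW=> b t; elim/fracW=> c r.
have [a' [b' [w [-> ->]]]] := frac_common a s b t.
by rewrite fracD !loc_mulE fracD mulrDl.
Qed.

Fact loc_mulDr : right_distributive loc_mul +%R.
Proof.
elim/fracW=> a s; elim/fracW=> b t; elim/fracW=> c r.
have [b' [c' [w [-> ->]]]] := frac_common b t c r.
by rewrite fracD !loc_mulE fracD mulrDr.
Qed.

Fact loc_1neq0 : frac 1 den1 != 0.
Proof.
apply/eqP => /fracP[u]; rewrite !mul1r mulr1 mulr0 => u0.
by have := svalP u; rewrite u0; apply: mset_neq0.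
Qed.

HB.instance Definition _ := GRing.Zmodule_isNzRing.Build loc
  loc_mulA loc_mul1 loc_1mul loc_mulDl loc_mulDr loc_1neq0.

Lemma fracM a s b t : frac a s * frac b t = frac (a * b) (denM s t).
Proof. exact: loc_mulE. Qed.

Definition loc_scale (c : R[i]) : loc -> loc := loc_lift1 ( *:%R c).

Lemma fracZ c a s : loc_scale c (frac a s) = frac (c *: a) s.
Proof.
by apply: loc_lift1E => [? ?|? ?]; rewrite ?scalerDr // -scalerAr.
Qed.

Fact loc_scaleA c d x : loc_scale c (loc_scale d x) = loc_scale (c * d) x.
Proof. by elim/fracW: x => a s; rewrite !fracZ scalerA. Qed.

Fact loc_scale1 : left_id 1 loc_scale.
Proof. by elim/fracW=> a s; rewrite fracZ scale1r. Qed.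

Fact loc_scaleDr : right_distributive loc_scale +%R.
Proof.
move=> c; elim/fracW=> a s; elim/fracW=> b t.
have [a' [b' [w [-> ->]]]] := frac_common a s b t.
by rewrite fracD !fracZ fracD scalerDr.
Qed.

Fact loc_scaleDl x : {morph loc_scale^~ x : c d / c + d}.
Proof. by elim/fracW: x => a s c d /=; rewrite !fracZ fracD scalerDl. Qed.

HB.instance Definition _ := GRing.Zmodule_isLmodule.Build R[i] loc
  loc_scaleA loc_scale1 loc_scaleDr loc_scaleDl.

Fact loc_scaleAl (c : R[i]) (x y : loc) : c *: (x * y) = (c *: x) * y.
Proof.
elim/fracW: x => a s; elim/fracW: y => b t.
by rewrite /GRing.scale /= fracM !fracZ fracM scalerAl.
Qed.

HB.instance Definition _ := GRing.Lmodule_isLalgebra.Build R[i] loc loc_scaleAl.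

Fact loc_scaleAr (c : R[i]) (x y : loc) : c *: (x * y) = x * (c *: y).
Proof.
elim/fracW: x => a s; elim/fracW: y => b t.
by rewrite /GRing.scale /= fracM !fracZ fracM scalerAr.
Qed.

HB.instance Definition _ := GRing.Lalgebra_isAlgebra.Build R[i] loc loc_scaleAr.

Definition loc_star : loc -> loc := loc_lift1 star.

Lemma frac_star a s : loc_star (frac a s) = frac (star a) s.
Proof.
apply: loc_lift1E => [? ?|t b]; rewrite ?starD // starM.
by rewrite (mset_herm (svalP t)) (mset_central (svalP t)).
Qed.

Fact loc_starK : involutive loc_star.
Proof. by elim/fracW=> a s; rewrite !frac_star starK. Qed.

Fact loc_starD : {morph loc_star : a b / a + b}.
Proof.
elim/fracW=> a s; elim/fracW=> b t.
have [a' [b' [w [-> ->]]]] := frac_common a s b t.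
by rewrite fracD !frac_star fracD starD.
Qed.

Fact loc_starM x y : loc_star (x * y) = loc_star y * loc_star x.
Proof.
elim/fracW: x => a s; elim/fracW: y => b t.
by rewrite fracM !frac_star fracM starM denMC.
Qed.

Fact loc_starZ (c : R[i]) (x : loc) : loc_star (c *: x) = c^*%C *: loc_star x.
Proof.
elim/fracW: x => a s.
by rewrite /GRing.scale /= frac_star !fracZ frac_star starZ.
Qed.

HB.instance Definition _ :=
  isStarAlgebra.Build R loc loc_starK loc_starD loc_starM loc_starZ.

Definition loc_unit : {pred loc} :=
  [pred x | `[< exists y, y * x = 1 /\ x * y = 1 >]].
Definition loc_inv (x : loc) : loc :=
  if pselect (exists y, y * x = 1 /\ x * y = 1) is left ex
  then sval (cid ex) else x.

Fact loc_mulVr : {in loc_unit, left_inverse 1 loc_inv *%R}.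
Proof.
move=> x /asboolP ex.
rewrite /loc_inv; case: pselect => [e|/(_ ex)[]]; exact: (svalP (cid e)).1.
Qed.

Fact loc_mulrV : {in loc_unit, right_inverse 1 loc_inv *%R}.
Proof.
move=> x /asboolP ex.
rewrite /loc_inv; case: pselect => [e|/(_ ex)[]]; exact: (svalP (cid e)).2.
Qed.

Fact loc_unitP x y : y * x = 1 /\ x * y = 1 -> loc_unit x.
Proof. by move=> xy; apply/asboolP; exists y. Qed.

Fact loc_invr_out : {in [predC loc_unit], loc_inv =1 id}.
Proof.
move=> x /asboolPn nex.
by rewrite /loc_inv; case: pselect => [e|//]; case: (nex e).
Qed.

HB.instance Definition _ := GRing.NzRing_hasMulInverse.Build loc
  loc_mulVr loc_mulrV loc_unitP loc_invr_out.

Definition to_loc (a : A) : loc := frac a den1.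

Lemma to_loc_unit (s : den) : to_loc (sval s) \is a GRing.unit.
Proof.
apply/unitrP; exists (frac 1 s).
by rewrite !fracM; split; apply: frac_ext; rewrite /= ?mul1r ?mulr1.
Qed.

End Localization.

Definition qtheta (R : realType) (theta : R) : R[i] :=
  cos (2 * pi * theta) +i* sin (2 * pi * theta).

Inductive s4_term (R : realType) : Type :=
| gZ | gW | gT
| tzero | tone
| tadd of s4_term R & s4_term R
| topp of s4_term R
| tmul of s4_term R & s4_term R
| tscale of R[i] & s4_term R
| tstar of s4_term R.

Arguments gZ {R}. Arguments gW {R}. Arguments gT {R}.
Arguments tzero {R}. Arguments tone {R}.

HB.instance Definition _ (R : realType) := gen_eqMixin (s4_term R).
HB.instance Definition _ (R : realType) := gen_choiceMixin (s4_term R).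

(* The least congruence on terms containing the axioms of unital star-algebras
   over R[i] (constructors ax_) and the defining relations (constructors
   rel_). *)
Inductive s4_eq (R : realType) (theta : R) : s4_term R -> s4_term R -> Prop :=
| cong_refl a : s4_eq theta a a
| cong_sym a b : s4_eq theta a b -> s4_eq theta b a
| cong_trans a b c : s4_eq theta a b -> s4_eq theta b c -> s4_eq theta a c
| cong_add a a' b b' : s4_eq theta a a' -> s4_eq theta b b' ->
    s4_eq theta (tadd a b) (tadd a' b')
| cong_opp a a' : s4_eq theta a a' -> s4_eq theta (topp a) (topp a')
| cong_mul a a' b b' : s4_eq theta a a' -> s4_eq theta b b' ->
    s4_eq theta (tmul a b) (tmul a' b')
| cong_scale k a a' : s4_eq theta a a' -> s4_eq theta (tscale k a) (tscale k a')
| cong_star a a' : s4_eq theta a a' -> s4_eq theta (tstar a) (tstar a')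

| ax_addA a b c : s4_eq theta (tadd a (tadd b c)) (tadd (tadd a b) c)
| ax_addC a b : s4_eq theta (tadd a b) (tadd b a)
| ax_add0 a : s4_eq theta (tadd tzero a) a
| ax_addN a : s4_eq theta (tadd (topp a) a) tzero
| ax_mulA a b c : s4_eq theta (tmul a (tmul b c)) (tmul (tmul a b) c)
| ax_1mul a : s4_eq theta (tmul tone a) a
| ax_mul1 a : s4_eq theta (tmul a tone) a
| ax_mulDl a b c :
    s4_eq theta (tmul (tadd a b) c) (tadd (tmul a c) (tmul b c))
| ax_mulDr a b c :
    s4_eq theta (tmul a (tadd b c)) (tadd (tmul a b) (tmul a c))

| ax_scaleA k l a : s4_eq theta (tscale k (tscale l a)) (tscale (k * l) a)
| ax_scale1 a : s4_eq theta (tscale 1 a) a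
| ax_scaleDr k a b :
    s4_eq theta (tscale k (tadd a b)) (tadd (tscale k a) (tscale k b))
| ax_scaleDl k l a :
    s4_eq theta (tscale (k + l) a) (tadd (tscale k a) (tscale l a))
| ax_scaleAl k a b : s4_eq theta (tscale k (tmul a b)) (tmul (tscale k a) b)
| ax_scaleAr k a b : s4_eq theta (tscale k (tmul a b)) (tmul a (tscale k b))

| ax_starK a : s4_eq theta (tstar (tstar a)) a
| ax_starD a b : s4_eq theta (tstar (tadd a b)) (tadd (tstar a) (tstar b))
| ax_starM a b : s4_eq theta (tstar (tmul a b)) (tmul (tstar b) (tstar a))
| ax_starZ k a : s4_eq theta (tstar (tscale k a)) (tscale k^*%C (tstar a))

| rel_WZ : s4_eq theta (tmul gW gZ) (tscale (qtheta theta) (tmul gZ gW))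
| rel_WsZ : s4_eq theta (tmul (tstar gW) gZ)
                        (tscale (qtheta theta)^*%C (tmul gZ (tstar gW)))
| rel_sphere : s4_eq theta
    (tadd (tadd (tmul gZ (tstar gZ)) (tmul gW (tstar gW))) (tmul gT gT)) tone
| rel_Ts : s4_eq theta (tstar gT) gT
| rel_TZ : s4_eq theta (tmul gT gZ) (tmul gZ gT)
| rel_TW : s4_eq theta (tmul gT gW) (tmul gW gT)
| rel_WWs : s4_eq theta (tmul gW (tstar gW)) (tmul (tstar gW) gW)
| rel_ZZs : s4_eq theta (tmul gZ (tstar gZ)) (tmul (tstar gZ) gZ).

(* A representation on functions int -> R[i], used only to see that the
   elements at which S^4_theta is localized are nonzero.  A term is sent to a
   pair of operators, the second one representing its star. *)
Section Model.
Variables (R : realType) (theta : R).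
Local Notation C := R[i].
Local Notation F := (int -> C).
Local Notation q := (qtheta theta).

Lemma qqbar : q * q^*%C = 1.
Proof.
rewrite /qtheta; simpc; apply/eqP; rewrite eq_complex /=.
by rewrite [sin _ * cos _]mulrC addNr -!expr2 cos2Dsin2 !eqxx.
Qed.

Lemma q_neq0 : q != 0.
Proof.
apply/eqP => q0; have := qqbar.
by rewrite q0 mul0r => /eqP; rewrite eq_sym oner_eq0.
Qed.

Lemma qbarE : q^*%C = q^-1.
Proof. by rewrite -[RHS]mulr1 -qqbar mulKf // q_neq0. Qed.

Let h : C := 2 / 3.

Fixpoint sem (e : s4_term R) : (F -> F) * (F -> F) :=
  match e with
  | gZ => (fun f n => h * (q ^ n * f n), fun f n => h * (q ^ (- n) * f n))
  | gW => (fun f n => h * f (n + 1), fun f n => h * f (n - 1))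
  | gT => (fun f n => 3^-1 * f n, fun f n => 3^-1 * f n)
  | tzero => (fun _ _ => 0, fun _ _ => 0)
  | tone => (id, id)
  | tadd a b => (fun f n => (sem a).1 f n + (sem b).1 f n,
                 fun f n => (sem a).2 f n + (sem b).2 f n)
  | topp a => (fun f n => - (sem a).1 f n, fun f n => - (sem a).2 f n)
  | tmul a b => ((sem a).1 \o (sem b).1, (sem b).2 \o (sem a).2)
  | tscale c a => (fun f n => c * (sem a).1 f n,
                   fun f n => c^*%C * (sem a).2 f n)
  | tstar a => ((sem a).2, (sem a).1)
  end.

Lemma sem_lin e c (f g : F) :
  (sem e).1 (fun n => c * f n + g n) =
    (fun n => c * (sem e).1 f n + (sem e).1 g n) /\
  (sem e).2 (fun n => c * f n + g n) =
    (fun n => c * (sem e).2 f n + (sem e).2 g n).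
Proof.
elim: e c f g => [|||||a IHa b IHb|a IHa|a IHa b IHb|k a IHa|a IHa] c f g /=.
- by split; apply/funext => n; ring.
- by split; apply/funext => n; ring.
- by split; apply/funext => n; ring.
- by split; apply/funext => n; ring.
- by [].
- rewrite !(IHa c f g).1 !(IHa c f g).2 !(IHb c f g).1 !(IHb c f g).2.
  by split; apply/funext => n; ring.
- by rewrite (IHa c f g).1 (IHa c f g).2; split; apply/funext => n; ring.
- by rewrite (IHb c f g).1 (IHa c f g).2 (IHa c _ _).1 (IHb c _ _).2.
- by rewrite (IHa c f g).1 (IHa c f g).2; split; apply/funext => n; ring.
- by have [] := IHa c f g.
Qed.

Lemma semD e (f g : F) :
  (sem e).1 (fun n => f n + g n) =
    (fun n => (sem e).1 f n + (sem e).1 g n) /\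
  (sem e).2 (fun n => f n + g n) =
    (fun n => (sem e).2 f n + (sem e).2 g n).
Proof.
have := sem_lin e 1 f g.
rewrite (_ : (fun n => 1 * f n + g n) = (fun n => f n + g n)).
  by move=> [-> ->]; split; apply/funext => n; rewrite mul1r.
by apply/funext => n; rewrite mul1r.
Qed.

Lemma semZ e c (f : F) :
  (sem e).1 (fun n => c * f n) = (fun n => c * (sem e).1 f n) /\
  (sem e).2 (fun n => c * f n) = (fun n => c * (sem e).2 f n).
Proof.
have [e1 e2] := semD e (fun=> 0) (fun=> 0).
have z1 : (sem e).1 (fun=> 0) = fun=> 0.
  apply/funext => n; move: e1; rewrite (_ : (fun=> 0 + 0) = (fun=> 0)).
    by move/(congr1 (@^~ n))/eqP; rewrite eq_sym -subr_eq0 addrK => /eqP.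
  by apply/funext => m; rewrite addr0.
have z2 : (sem e).2 (fun=> 0) = fun=> 0.
  apply/funext => n; move: e2; rewrite (_ : (fun=> 0 + 0) = (fun=> 0)).
    by move/(congr1 (@^~ n))/eqP; rewrite eq_sym -subr_eq0 addrK => /eqP.
  by apply/funext => m; rewrite addr0.
have := sem_lin e c f (fun=> 0).
rewrite (_ : (fun n => c * f n + 0) = (fun n => c * f n)).
  by rewrite z1 z2 => -[-> ->]; split; apply/funext => n; rewrite addr0.
by apply/funext => n; rewrite addr0.
Qed.

Lemma sem_eq a b : s4_eq theta a b -> sem a = sem b.
Proof.
have pairP (x y : (F -> F) * (F -> F)) :
    (forall f n, x.1 f n = y.1 f n) -> (forall f n, x.2 f n = y.2 f n) -> x = y.
  case: x y => [x1 x2] [y1 y2] /= e1 e2.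
  by congr (_, _); apply/funext => f; apply/funext => n.
have h0 : (3 : C) != 0 by rewrite pnatr_eq0.
have q0 := q_neq0.
elim=> {a b}; try by move=> /= *; congruence.
all: try by move=> /= *; apply: pairP => f n /=; ring.
- by move=> a a' b b' _ ea _ eb /=; rewrite ea eb.
- by move=> a a' _ /= ->.
- by move=> k a a' _ /= ->.
- by move=> a b c; apply: pairP => f n //=; rewrite (semD c _ _).2.
- by move=> a b c; apply: pairP => f n //=; rewrite (semD a _ _).1.
- move=> a; rewrite [LHS]/sem -/sem conjc1.
  by apply: pairP => f n; apply: mul1r.
- by move=> k a b; apply: pairP => f n //=; rewrite (semZ b _ _).2.
- by move=> k a b; apply: pairP => f n //=; rewrite (semZ a _ _).1.
- by move=> k a; apply: pairP => f n //=; rewrite conjcK.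
- rewrite [LHS]/sem [RHS]/sem qbarE; apply: pairP => f n /=.
    by rewrite expfzDr // expr1z; ring.
  by rewrite opprB expfzDr // expr1z; field.
- rewrite [LHS]/sem [RHS]/sem conjcK qbarE; apply: pairP => f n /=.
    by rewrite expfzDr // exprN1; field.
  by rewrite opprD expfzDr // exprN1; field.
- have qq m (x : C) : q ^ m * (q ^ (- m) * x) = x.
    by rewrite mulrA -expfzDr // subrr expr0z mul1r.
  apply: pairP => f n /=.
    rewrite [q ^ n * _]mulrCA qq addrK /h.
    by field.
  rewrite [q ^ n * _]mulrCA qq addrK /h.
  by field.
- by apply: pairP => f n /=; rewrite ?subrK ?addrK.
Qed.

End Model.

Section Sphere.
Variables (R : realType) (theta : R).

Definition s4_eqb (a b : s4_term R) : bool := `[< s4_eq theta a b >].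

Fact s4_equiv_class : equiv_class_of s4_eqb.
Proof.
split.
- by move=> a; apply/asboolP; apply: cong_refl.
- by move=> a b; apply/asboolP/asboolP; apply: cong_sym.
- by move=> b a c /asboolP ab /asboolP bc; apply/asboolP; apply: cong_trans ab bc.
Qed.

Canonical s4_equiv := EquivRelPack s4_equiv_class.

Definition S4 := {eq_quot s4_equiv}.
HB.instance Definition _ := Choice.on S4.

Definition s4_class (a : s4_term R) : S4 := \pi_S4 a.

Lemma s4_classP a b : s4_class a = s4_class b <-> s4_eq theta a b.
Proof.
split=> [/eqP|e]; first by rewrite eqmodE => /asboolP.
by apply/eqP; rewrite eqmodE; apply/asboolP.
Qed.

Lemma s4_classW (P : S4 -> Prop) : (forall a, P (s4_class a)) -> forall x, P x.
Proof. by move=> Pc x; rewrite -[x]reprK. Qed.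

Lemma s4_repr a : s4_eq theta (repr (s4_class a)) a.
Proof. by apply/s4_classP; rewrite /s4_class reprK. Qed.

Let add (x y : S4) := s4_class (tadd (repr x) (repr y)).
Let opp (x : S4) := s4_class (topp (repr x)).
Let mul (x y : S4) := s4_class (tmul (repr x) (repr y)).
Let scale (c : R[i]) (x : S4) := s4_class (tscale c (repr x)).
Let st (x : S4) := s4_class (tstar (repr x)).

Let addE a b : add (s4_class a) (s4_class b) = s4_class (tadd a b).
Proof. by apply/s4_classP; apply: cong_add; apply: s4_repr. Qed.
Let oppE a : opp (s4_class a) = s4_class (topp a).
Proof. by apply/s4_classP; apply: cong_opp; apply: s4_repr. Qed.
Let mulE a b : mul (s4_class a) (s4_class b) = s4_class (tmul a b).
Proof. by apply/s4_classP; apply: cong_mul; apply: s4_repr. Qed.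
Let scaleE c a : scale c (s4_class a) = s4_class (tscale c a).
Proof. by apply/s4_classP; apply: cong_scale; apply: s4_repr. Qed.
Let stE a : st (s4_class a) = s4_class (tstar a).
Proof. by apply/s4_classP; apply: cong_star; apply: s4_repr. Qed.
Let E := (addE, oppE, mulE, scaleE, stE).

Fact s4_addA : associative add.
Proof.
elim/s4_classW=> a; elim/s4_classW=> b; elim/s4_classW=> c.
by rewrite !E; apply/s4_classP; apply: ax_addA.
Qed.

Fact s4_addC : commutative add.
Proof.
elim/s4_classW=> a; elim/s4_classW=> b.
by rewrite !E; apply/s4_classP; apply: ax_addC.
Qed.

Fact s4_add0 : left_id (s4_class tzero) add.
Proof. by elim/s4_classW=> a; rewrite !E; apply/s4_classP; apply: ax_add0. Qed.

Fact s4_addN : left_inverse (s4_class tzero) opp add.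
Proof. by elim/s4_classW=> a; rewrite !E; apply/s4_classP; apply: ax_addN. Qed.

HB.instance Definition _ :=
  GRing.isZmodule.Build S4 s4_addA s4_addC s4_add0 s4_addN.

Fact s4_mulA : associative mul.
Proof.
elim/s4_classW=> a; elim/s4_classW=> b; elim/s4_classW=> c.
by rewrite !E; apply/s4_classP; apply: ax_mulA.
Qed.

Fact s4_1mul : left_id (s4_class tone) mul.
Proof. by elim/s4_classW=> a; rewrite !E; apply/s4_classP; apply: ax_1mul. Qed.

Fact s4_mul1 : right_id (s4_class tone) mul.
Proof. by elim/s4_classW=> a; rewrite !E; apply/s4_classP; apply: ax_mul1. Qed.

Fact s4_mulDl : left_distributive mul +%R.
Proof.
elim/s4_classW=> a; elim/s4_classW=> b; elim/s4_classW=> c.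
by rewrite /GRing.add /= !E; apply/s4_classP; apply: ax_mulDl.
Qed.

Fact s4_mulDr : right_distributive mul +%R.
Proof.
elim/s4_classW=> a; elim/s4_classW=> b; elim/s4_classW=> c.
by rewrite /GRing.add /= !E; apply/s4_classP; apply: ax_mulDr.
Qed.

Fact s4_1neq0 : s4_class tone != s4_class tzero.
Proof.
apply/eqP => /s4_classP/sem_eq/(congr1 fst)/(congr1 (fun g => g (fun=> 1) 0)).
by move/eqP; rewrite /= oner_eq0.
Qed.

HB.instance Definition _ := GRing.Zmodule_isNzRing.Build S4
  s4_mulA s4_1mul s4_mul1 s4_mulDl s4_mulDr s4_1neq0.

Fact s4_scaleA c d x : scale c (scale d x) = scale (c * d) x.
Proof.
by elim/s4_classW: x => a; rewrite !E; apply/s4_classP; apply: ax_scaleA.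
Qed.

Fact s4_scale1 : left_id 1 scale.
Proof.
by elim/s4_classW=> a; rewrite !E; apply/s4_classP; apply: ax_scale1.
Qed.

Fact s4_scaleDr : right_distributive scale +%R.
Proof.
move=> c; elim/s4_classW=> a; elim/s4_classW=> b.
by rewrite /GRing.add /= !E; apply/s4_classP; apply: ax_scaleDr.
Qed.

Fact s4_scaleDl x : {morph scale^~ x : c d / c + d}.
Proof.
elim/s4_classW: x => a c d; rewrite /= !E; rewrite [RHS]/GRing.add /= !E.
by apply/s4_classP; apply: ax_scaleDl.
Qed.

HB.instance Definition _ := GRing.Zmodule_isLmodule.Build R[i] S4
  s4_scaleA s4_scale1 s4_scaleDr s4_scaleDl.

Fact s4_scaleAl (c : R[i]) (x y : S4) : c *: (x * y) = (c *: x) * y.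
Proof.
elim/s4_classW: x => a; elim/s4_classW: y => b.
rewrite /GRing.scale /GRing.mul /= !E.
by apply/s4_classP; apply: ax_scaleAl.
Qed.

HB.instance Definition _ := GRing.Lmodule_isLalgebra.Build R[i] S4 s4_scaleAl.

Fact s4_scaleAr (c : R[i]) (x y : S4) : c *: (x * y) = x * (c *: y).
Proof.
elim/s4_classW: x => a; elim/s4_classW: y => b.
rewrite /GRing.scale /GRing.mul /= !E.
by apply/s4_classP; apply: ax_scaleAr.
Qed.

HB.instance Definition _ := GRing.Lalgebra_isAlgebra.Build R[i] S4 s4_scaleAr.

Fact s4_starK : involutive st.
Proof. by elim/s4_classW=> a; rewrite !E; apply/s4_classP; apply: ax_starK. Qed.

Fact s4_starD : {morph st : a b / a + b}.
Proof.
elim/s4_classW=> a; elim/s4_classW=> b; rewrite /GRing.add /= !E.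
by apply/s4_classP; apply: ax_starD.
Qed.

Fact s4_starM (x y : S4) : st (x * y) = st y * st x.
Proof.
elim/s4_classW: x => a; elim/s4_classW: y => b; rewrite /GRing.mul /= !E.
by apply/s4_classP; apply: ax_starM.
Qed.

Fact s4_starZ (c : R[i]) (x : S4) : st (c *: x) = c^*%C *: st x.
Proof.
elim/s4_classW: x => a; rewrite /GRing.scale /= !E.
by apply/s4_classP; apply: ax_starZ.
Qed.

HB.instance Definition _ :=
  isStarAlgebra.Build R S4 s4_starK s4_starD s4_starM s4_starZ.

Definition s4Z : S4 := s4_class gZ.
Definition s4W : S4 := s4_class gW.
Definition s4T : S4 := s4_class gT.

Lemma s4_addE a b : s4_class (tadd a b) = s4_class a + s4_class b.
Proof. exact/esym/addE. Qed.
Lemma s4_oppE a : s4_class (topp a) = - s4_class a.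
Proof. exact/esym/oppE. Qed.
Lemma s4_mulE a b : s4_class (tmul a b) = s4_class a * s4_class b.
Proof. exact/esym/mulE. Qed.
Lemma s4_scaleE c a : s4_class (tscale c a) = c *: s4_class a.
Proof. exact/esym/scaleE. Qed.
Lemma s4_starE a : s4_class (tstar a) = star (s4_class a).
Proof. exact/esym/stE. Qed.
Lemma s4_oneE : s4_class tone = 1. Proof. by []. Qed.
Lemma s4_zeroE : s4_class tzero = 0. Proof. by []. Qed.
Definition s4E :=
  (s4_addE, s4_oppE, s4_mulE, s4_scaleE, s4_starE, s4_oneE, s4_zeroE).

Local Notation q := (qtheta theta).

Lemma s4WZ : s4W * s4Z = q *: (s4Z * s4W).
Proof. by move/s4_classP: (rel_WZ theta); rewrite !s4E. Qed.
Lemma s4WsZ : star s4W * s4Z = q^*%C *: (s4Z * star s4W).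
Proof. by move/s4_classP: (rel_WsZ theta); rewrite !s4E. Qed.
Lemma s4_sphere : s4Z * star s4Z + s4W * star s4W + s4T ^+ 2 = 1.
Proof. by move/s4_classP: (rel_sphere theta); rewrite !s4E. Qed.
Lemma s4Ts : star s4T = s4T.
Proof. by move/s4_classP: (rel_Ts theta); rewrite !s4E. Qed.
Lemma s4TZ : s4T * s4Z = s4Z * s4T.
Proof. by move/s4_classP: (rel_TZ theta); rewrite !s4E. Qed.
Lemma s4TW : s4T * s4W = s4W * s4T.
Proof. by move/s4_classP: (rel_TW theta); rewrite !s4E. Qed.
Lemma s4WWs : s4W * star s4W = star s4W * s4W.
Proof. by move/s4_classP: (rel_WWs theta); rewrite !s4E. Qed.
Lemma s4ZZs : s4Z * star s4Z = star s4Z * s4Z.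
Proof. by move/s4_classP: (rel_ZZs theta); rewrite !s4E. Qed.

Lemma s4_centralP (x : S4) :
    GRing.comm x s4Z -> GRing.comm x (star s4Z) ->
    GRing.comm x s4W -> GRing.comm x (star s4W) -> GRing.comm x s4T ->
  forall a, x * a = a * x.
Proof.
move=> xZ xZs xW xWs xT; elim/s4_classW=> a.
have: x * s4_class a = s4_class a * x /\
      x * star (s4_class a) = star (s4_class a) * x.
  elim: a => [|||||a [a1 a2] b [b1 b2]|a [a1 a2]|a [a1 a2] b [b1 b2]
             |c a [a1 a2]|a [a1 a2]].
  - by [].
  - by [].
  - by rewrite s4Ts.
  - by rewrite s4_zeroE star0 mulr0 mul0r.
  - by rewrite s4_oneE star1 mulr1 mul1r.
  - by rewrite s4E starD !mulrDr !mulrDl a1 a2 b1 b2.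
  - by rewrite s4E starN !mulrN !mulNr a1 a2.
  - by rewrite s4E starM !mulrA a1 b2 -!mulrA b1 a2.
  - by rewrite s4E starZ -!scalerAr -!scalerAl a1 a2.
  - by rewrite s4E starK a1 a2.
by case.
Qed.

Lemma s4WZs : s4W * star s4Z = q^*%C *: (star s4Z * s4W).
Proof.
have := congr1 star s4WsZ; rewrite starM starK starZ conjcK starM starK => ->.
by rewrite scalerA mulrC qqbar scale1r.
Qed.

Lemma s4WsZs : star s4W * star s4Z = q *: (star s4Z * star s4W).
Proof.
have := congr1 star s4WZ; rewrite starM starZ starM => ->.
by rewrite scalerA qqbar scale1r.
Qed.

Lemma s4TZs : s4T * star s4Z = star s4Z * s4T.
Proof. by have := congr1 star s4TZ; rewrite !starM s4Ts. Qed.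

Lemma s4TWs : s4T * star s4W = star s4W * s4T.
Proof. by have := congr1 star s4TW; rewrite !starM s4Ts. Qed.

Lemma s4Z2_central a : s4Z * star s4Z * a = a * (s4Z * star s4Z).
Proof.
apply: s4_centralP a; rewrite /GRing.comm.
- by rewrite -mulrA -s4ZZs.
- by rewrite {1}s4ZZs -mulrA.
- rewrite [RHS]mulrA s4WZ -scalerAl -[in RHS]mulrA s4WZs -scalerAr scalerA qqbar scale1r.
  by rewrite mulrA.
- rewrite [RHS]mulrA s4WsZ -scalerAl -[in RHS]mulrA s4WsZs -scalerAr scalerA.
  by rewrite [_ * q]mulrC qqbar scale1r mulrA.
- by rewrite mulrA s4TZ -!mulrA s4TZs.
Qed.

Lemma s4T_central a : s4T * a = a * s4T.
Proof.
by apply: s4_centralP a => //; [exact: s4TZ|exact: s4TZs|exact: s4TW|exact: s4TWs].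
Qed.

Lemma s4T2_central a : s4T ^+ 2 * a = a * s4T ^+ 2.
Proof. by rewrite expr2 -mulrA s4T_central -mulrA s4T_central mulrA. Qed.

Lemma s4W2E : s4W * star s4W = 1 - s4T ^+ 2 - s4Z * star s4Z.
Proof.
by rewrite -s4_sphere addrK addrC addrA addNr add0r.
Qed.

Lemma s4W2_central a : s4W * star s4W * a = a * (s4W * star s4W).
Proof.
by rewrite s4W2E !mulrBr !mulrBl mul1r mulr1 s4T2_central s4Z2_central.
Qed.

Inductive s4_mset_pred : S4 -> Prop :=
| ms_1 : s4_mset_pred 1
| ms_Z2 : s4_mset_pred (s4Z * star s4Z)
| ms_W2 : s4_mset_pred (s4W * star s4W)
| ms_1BT2 : s4_mset_pred (1 - s4T ^+ 2)
| ms_1DT2 : s4_mset_pred (1 + s4T ^+ 2)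
| ms_M s t : s4_mset_pred s -> s4_mset_pred t -> s4_mset_pred (s * t).

Fact s4_mset_central s : s4_mset_pred s -> forall a, s * a = a * s.
Proof.
elim=> [|||||{}s t _ cs _ ct] a.
- by rewrite mul1r mulr1.
- exact: s4Z2_central.
- exact: s4W2_central.
- by rewrite mulrBl mulrBr mul1r mulr1 s4T2_central.
- by rewrite mulrDl mulrDr mul1r mulr1 s4T2_central.
- by rewrite -mulrA ct mulrA cs mulrA.
Qed.

Fact s4_mset_herm s : s4_mset_pred s -> star s = s.
Proof.
elim=> [|||||{}s t ms hs _ ht].
- exact: star1.
- by rewrite starM starK.
- by rewrite starM starK.
- by rewrite starD starN star1 expr2 starM s4Ts.
- by rewrite starD star1 expr2 starM s4Ts.
- by rewrite starM hs ht (s4_mset_central ms).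
Qed.

Fact s4_mset_sem s : s4_mset_pred s ->
  exists a c, [/\ s = s4_class a, c != 0 &
    forall f n, (sem theta a).1 f n = c * f n].
Proof.
have h0 : (2 / 3 : R[i]) != 0 by rewrite mulf_neq0 ?invr_eq0 ?pnatr_eq0.
have q0 := q_neq0 theta.
elim=> [|||||{}s t _ [a [c [-> c0 ac]]] _ [b [d [-> d0 bd]]]].
- by exists tone, 1; split=> [||f n]; rewrite ?oner_eq0 ?mul1r.
- exists (tmul gZ (tstar gZ)), (2 / 3 * (2 / 3)); split.
  + by rewrite !s4E.
  + by rewrite mulf_neq0.
  + move=> f n /=; rewrite [q ^ n * _]mulrCA (mulrA (q ^ n)) -expfzDr //.
    by rewrite subrr expr0z mul1r !mulrA.
- exists (tmul gW (tstar gW)), (2 / 3 * (2 / 3)); split.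
  + by rewrite !s4E.
  + by rewrite mulf_neq0.
  + by move=> f n /=; rewrite addrK !mulrA.
- exists (tadd tone (topp (tmul gT gT))), (8 / 9); split.
  + by rewrite !s4E expr2.
  + by rewrite mulf_neq0 ?invr_eq0 ?pnatr_eq0.
  + by move=> f n /=; field.
- exists (tadd tone (tmul gT gT)), (10 / 9); split.
  + by rewrite !s4E expr2.
  + by rewrite mulf_neq0 ?invr_eq0 ?pnatr_eq0.
  + by move=> f n /=; field.
- exists (tmul a b), (c * d); split.
  + by rewrite !s4E.
  + by rewrite mulf_neq0.
  + by move=> f n /=; rewrite ac bd mulrA.
Qed.

Fact s4_mset_neq0 : ~ s4_mset_pred 0.
Proof.
move/s4_mset_sem => [a [c [/s4_classP/sem_eq a0 c0 ac]]].
have := ac (fun=> 1) 0; rewrite -a0 /= mulr1 => c00.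
by rewrite -c00 eqxx in c0.
Qed.

Definition s4_mset : central_mset S4 :=
  CentralMset ms_1 ms_M s4_mset_central s4_mset_herm s4_mset_neq0.

Definition S4loc : unitStarAlgType R := loc s4_mset.

End Sphere.

(* Right A-modules are left modules over the converse ring A^c. *)
Definition ract (R : realType) (A : starAlgType R) (a : A) (M : lmodType A^c)
  (U : M) : M := (a : A^c) *: U.
Notation "U :*r a" := (ract a U) (at level 40, left associativity) : ring_scope.

Section Calculus.
Variables (R : realType) (A : starAlgType R) (M : lmodType A^c).

Definition derivation (d : A -> A) : Prop :=
  linear d /\ forall a b, d (a * b) = d a * b + a * d b.

Definition hermitian_derivation (d : A -> A) : Prop :=
  derivation d /\ forall a, d (star a) = star (d a).

Definition lie_bracket (d1 d2 : A -> A) : A -> A :=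
  fun a => d1 (d2 a) - d2 (d1 a).

Record real_lie_algebra (g : set (A -> A)) : Prop := {
  rla_herm : forall d, g d -> hermitian_derivation d;
  rla_zero : g (fun=> 0);
  rla_add : forall d1 d2, g d1 -> g d2 -> g (d1 \+ d2);
  rla_scale : forall (r : R) d, g d -> g (r%:C \*: d);
  rla_bracket : forall d1 d2, g d1 -> g d2 -> g (lie_bracket d1 d2)
}.

Definition real_span (G : set (A -> A)) : set (A -> A) :=
  [set d | exists (n : nat) (r : 'I_n -> R) (D : 'I_n -> A -> A),
    (forall k, G (D k)) /\ d = fun a => \sum_(k < n) (r k)%:C *: D k a].

Definition real_linear_on (g : set (A -> A)) (phi : (A -> A) -> M) : Prop :=
  (forall d1 d2, g d1 -> g d2 -> phi (d1 \+ d2) = phi d1 + phi d2) /\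
  (forall (r : R) d, g d -> phi (r%:C \*: d) = phi d :*r (r%:C)%:A).

Record hermitian_form (h : M -> M -> A) : Prop := {
  hf_add : forall U V W, h U (V + W) = h U V + h U W;
  hf_mul : forall U V a, h U (V :*r a) = h U V * a;
  hf_star : forall U V, star (h U V) = h V U
}.

Definition metric (h : M -> M -> A) : Prop :=
  hermitian_form h /\ forall U, (forall V, h U V = 0) -> U = 0.

Definition generates (G : set M) : Prop :=
  forall U : M, exists (n : nat) (E : 'I_n -> M) (a : 'I_n -> A),
    (forall k, G (E k)) /\ U = \sum_(k < n) E k :*r a k.

(* The maps phi and nabla are total functions of a linear endomap of A, but
   only their values on g are constrained: they stand for maps on g. *)
Record real_metric_calculus (h : M -> M -> A) (g : set (A -> A))
    (phi : (A -> A) -> M) : Prop := {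
  rmc_metric : metric h;
  rmc_lie : real_lie_algebra g;
  rmc_phi : real_linear_on g phi;
  rmc_gen : generates (phi @` g);
  rmc_real : forall E E', (phi @` g) E -> (phi @` g) E' ->
    star (h E E') = h E E'
}.

Record affine_connection (g : set (A -> A)) (nabla : (A -> A) -> M -> M)
    : Prop := {
  ac_add : forall d U V, g d -> nabla d (U + V) = nabla d U + nabla d V;
  ac_linear : forall U, real_linear_on g (nabla^~ U);
  ac_leibniz : forall d U a, g d ->
    nabla d (U :*r a) = nabla d U :*r a + U :*r d a
}.

Record pseudo_riemannian_calculus (h : M -> M -> A) (g : set (A -> A))
    (phi : (A -> A) -> M) (nabla : (A -> A) -> M -> M) : Prop := {
  prc_rmc : real_metric_calculus h g phi;
  prc_connection : affine_connection g nabla;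
  prc_real : forall d E E', g d -> (phi @` g) E -> (phi @` g) E' ->
    h (nabla d E) E' = star (h (nabla d E) E');
  prc_metric : forall d U V, g d ->
    d (h U V) = h (nabla d U) V + h U (nabla d V);
  prc_torsion : forall d1 d2, g d1 -> g d2 ->
    nabla d1 (phi d2) - nabla d2 (phi d1) - phi (lie_bracket d1 d2) = 0
}.

End Calculus.

Section SphereModule.
Variables (R : realType) (theta : R).
Local Notation A := (S4loc theta).

Definition Zl : A := to_loc (s4_mset theta) (s4Z theta).
Definition Wl : A := to_loc (s4_mset theta) (s4W theta).
Definition Tl : A := to_loc (s4_mset theta) (s4T theta).
Definition Z2 : A := Zl * star Zl.
Definition W2 : A := Wl * star Wl.

Definition X1 : A := 2^-1 *: (Zl + star Zl).
Definition X2 : A := (2 * 'i%C)^-1 *: (Zl - star Zl).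
Definition X3 : A := 2^-1 *: (Wl + star Wl).
Definition X4 : A := (2 * 'i%C)^-1 *: (Wl - star Wl).

Definition row5 (a1 a2 a3 a4 a5 : A) : 'rV[A^c]_5 :=
  \row_(i < 5) nth 0 [:: a1; a2; a3; a4; a5] i.

Definition vE (a : 'I_4) : 'rV[A^c]_5 := tnth [tuple
  row5 (- X2 * (1 - Tl ^+ 2)) (X1 * (1 - Tl ^+ 2)) 0 0 0;
  row5 0 0 (- X4 * (1 - Tl ^+ 2)) (X3 * (1 - Tl ^+ 2)) 0;
  row5 (X1 * W2) (X2 * W2) (- X3 * Z2) (- X4 * Z2) 0;
  row5 (X1 * Tl) (X2 * Tl) (X3 * Tl) (X4 * Tl) (Tl ^+ 2 - 1)] a.

Definition in_spanE : {pred 'rV[A^c]_5} :=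
  fun V => `[< exists U : 'I_4 -> A, V = \sum_(a < 4) vE a :*r U a >].

Fact in_spanE_submod : submod_closed in_spanE.
Proof.
split=> [|c u v /asboolP[U ->] /asboolP[V ->]]; apply/asboolP.
  by exists (fun=> 0); rewrite big1 // => a _; rewrite /ract scale0r.
exists (fun a => U a * c + V a); rewrite scaler_sumr -big_split.
by apply: eq_bigr => a _; rewrite /ract /= scalerA [RHS]scalerDl.
Qed.

HB.instance Definition _ :=
  GRing.isSubmodClosed.Build A^c 'rV[A^c]_5 in_spanE in_spanE_submod.

Record M4 := SubM4 { M4val :> 'rV[A^c]_5; _ : M4val \in in_spanE }.
HB.instance Definition _ := [isSub for M4val].
HB.instance Definition _ := [Choice of M4 by <:].
HB.instance Definition _ := [SubChoice_isSubZmodule of M4 by <:].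
HB.instance Definition _ := [SubZmodule_isSubLmodule of M4 by <:].

Fact vE_in a : vE a \in in_spanE.
Proof.
apply/asboolP; exists (fun b => (a == b)%:R).
rewrite (bigD1 a) //= eqxx /ract scale1r big1 ?addr0 // => b.
by rewrite eq_sym => /negbTE ->; rewrite scale0r.
Qed.

Definition Efr (a : 'I_4) : M4 := SubM4 (vE_in a).
Definition E1 : M4 := Efr 0.
Definition E2 : M4 := Efr 1.
Definition E3 : M4 := Efr 2.
Definition E4 : M4 := Efr 3.

Fact M4_coordP (U : M4) :
  exists c : 'I_4 -> A, U = \sum_(a < 4) Efr a :*r c a.
Proof.
have /asboolP[c Uc] := valP U; exists c; apply: val_inj.
by rewrite Uc raddf_sum; apply: eq_bigr.
Qed.

(* The coefficients U^a of U = \sum_a E_a U^a (unique, as the E_a are free). *)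
Definition M4_coord (U : M4) : 'I_4 -> A := sval (cid (M4_coordP U)).

Definition h4_coef (a b : 'I_4) : A :=
  \sum_(i < 5) star (vE a 0 i : A) * (vE b 0 i : A).

Definition h4 (U V : M4) : A :=
  \sum_(a < 4) \sum_(b < 4)
    star (M4_coord U a) * h4_coef a b * M4_coord V b.

Definition h4_scaled (delta : A) (U V : M4) : A := delta * h4 U V.

Section Derivations.
Variables dt1 dt2 dt3 dt4 : A -> A.

Definition pd1 (n : nat) : A -> A := fun a => Tl ^+ n * (1 - Tl ^+ 2) * dt1 a.
Definition pd2 (n : nat) : A -> A := fun a => Tl ^+ n * (1 - Tl ^+ 2) * dt2 a.
Definition pd3 (n : nat) : A -> A := fun a => Tl ^+ n * dt3 a.

(* This real span is already closed under the Lie bracket. *)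
Definition g4 : set (A -> A) := real_span
  [set d | (exists n, d = pd1 n) \/ (exists n, d = pd2 n) \/
           (exists n, d = pd3 n) \/ d = dt4].
End Derivations.

End SphereModule.

Arguments Zl {R theta}.
Arguments Wl {R theta}.
Arguments Tl {R theta}.
Arguments Z2 {R theta}.
Arguments W2 {R theta}.
Arguments Efr {R theta}.
Arguments E1 {R theta}.
Arguments E2 {R theta}.
Arguments E3 {R theta}.
Arguments E4 {R theta}.

(* Main.v *)
Require Import Defs.
From HB Require Import structures.
From mathcomp Require Import all_boot all_order all_algebra.
From mathcomp Require Import complex.
From mathcomp Require Import all_classical all_reals trigo.
From mathcomp Require Import ring.

(** The whole calculus is linear algebra over the real centre of the algebra,
    that is, the commutative ring of its central hermitian elements.  That ring
    contains T, |Z|^2, |W|^2, the inverses of |Z|^2, |W|^2 and 1 - T^2, the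
    element delta and, because delta is central and regular, also the four
    elements alpha_a ([log_der_central]).  Hermitian derivations preserve it.

    Uniqueness ([prc_unique]) is the classical argument and holds in every
    pseudo-Riemannian calculus: if S is the difference of two connections, then
    h (S_d phi e, phi f) is symmetric in d, e since both are torsion free, and
    antisymmetric in e, f since both are metric and take hermitian values on
    M_phi.  A trilinear map with these two symmetries vanishes, and phi g
    generates M.

    For existence, the rows E_1, ..., E_4 form a free orthogonal frame of M
    with invertible square norms ([sphere_frame], [h4E]).  The row E_a lists the
    values of the derivation d_a on the coordinate functions X^i, so one table
    of five coefficients for each a describes both ([vE_row], [frame_der_Z],
    [frame_der_W], [frame_der_T]).  Up to antisymmetry the only nonzero
    brackets are [d_4, d_i] = 2 T d_i for i = 1, 2, 3 ([frame_der_bracket]).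
    In such a frame Koszul's formula defines symbols Gamma in the real centre,
    which satisfy the metric and torsion identities by pure algebra
    ([christoffel_metric], [christoffel_torsion]).  It uses only logarithmic
    derivatives of the square norms, so replacing h by delta h merely adds
    alpha_a to these and delta is never inverted ([conformal_metric]).  The
    covariant derivative along any d in g is then the derivative of the
    coordinates plus a linear term in the coordinates of phi d; as phi is given
    on all of g, this expression cannot depend on how d is written in terms of
    the spanning derivations ([frame_connection_calculus]).  The stated formulas
    are the values of Gamma ([christoffelE]).

    That g is closed under the bracket, and the value of phi on a bracket, come
    from describing g as the fields sum_a p_a(T) d_a with real polynomials p_a
    and p_4 constant ([g4_poly_field], [phi_poly_field]).  In the
    formal text the index sets start at 0, so that d_4, E_4 and p_4 have
    index 3. *)

Set Implicit Arguments.
Unset Strict Implicit.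
Unset Printing Implicit Defensive.

Import Order.TTheory GRing.Theory Num.Theory.

Local Open Scope classical_set_scope.
Local Open Scope ring_scope.
Local Open Scope complex_scope.

(** * Right modules and hermitian derivations *)

Section RightAction.
Variables (R : realType) (A : starAlgType R) (M : lmodType A^c).
Implicit Types (U V : M) (a b : A).

Lemma ractDl U V a : (U + V) :*r a = U :*r a + V :*r a.
Proof. exact: scalerDr. Qed.

Lemma ractDr U a b : U :*r (a + b) = U :*r a + U :*r b.
Proof. exact: scalerDl. Qed.

Lemma ractA U a b : U :*r a :*r b = U :*r (a * b).
Proof. by rewrite /ract scalerA. Qed.

Lemma ract0 U : U :*r 0 = 0.
Proof. exact: scale0r. Qed.

Lemma ract1 U : U :*r 1 = U.
Proof. exact: scale1r. Qed.

Lemma ractNl U a : (- U) :*r a = - (U :*r a).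
Proof. exact: scalerN. Qed.

Lemma ractNr U a : U :*r (- a) = - (U :*r a).
Proof. exact: scaleNr. Qed.

Lemma ract_suml (I : Type) (r : seq I) (P : pred I) (F : I -> M) a :
  (\sum_(i <- r | P i) F i) :*r a = \sum_(i <- r | P i) F i :*r a.
Proof. exact: scaler_sumr. Qed.

End RightAction.

Section Derivations.
Variables (R : realType) (A : starAlgType R) (d : A -> A).
Hypothesis dP : hermitian_derivation d.
Implicit Types a b : A.

Lemma der_star a : d (star a) = star (d a).
Proof. exact: dP.2. Qed.

Lemma derM a b : d (a * b) = d a * b + a * d b.
Proof. exact: dP.1.2. Qed.

Lemma derD a b : d (a + b) = d a + d b.
Proof. by have := dP.1.1 1 a b; rewrite !scale1r. Qed.

Lemma der0 : d 0 = 0.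
Proof. by apply: (addIr (d 0)); rewrite -derD !add0r. Qed.

Lemma derZ (c : R[i]) a : d (c *: a) = c *: d a.
Proof. by have := dP.1.1 c a 0; rewrite der0 !addr0. Qed.

Lemma derN a : d (- a) = - d a.
Proof. by rewrite -scaleN1r derZ scaleN1r. Qed.

Lemma der1 : d 1 = 0.
Proof.
by apply: (addIr (d 1)); rewrite add0r -{3}(mul1r 1) derM mulr1 mul1r.
Qed.

Lemma der_sum (I : Type) (r : seq I) (P : pred I) (F : I -> A) :
  d (\sum_(i <- r | P i) F i) = \sum_(i <- r | P i) d (F i).
Proof. exact: (big_morph d derD der0). Qed.

End Derivations.

(** * Uniqueness of the connection *)

Section Uniqueness.
Variables (R : realType) (A : starAlgType R) (M : lmodType A^c).
Variables (h : M -> M -> A) (g : set (A -> A)) (phi : (A -> A) -> M).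

Lemma eqN_eq0 (a : A) : a = - a -> a = 0.
Proof.
move=> aN; have : (2 : R[i]) *: a = 0.
  by rewrite scaler_nat mulr2n {1}aN addNr.
move/(congr1 (fun u => 2^-1 *: u)).
by rewrite scalerA mulVf ?pnatr_eq0 // scale1r scaler0.
Qed.

Section Form.
Hypothesis hP : hermitian_form h.

Lemma hf_addl U V W : h (U + V) W = h U W + h V W.
Proof. by rewrite -(hf_star hP) (hf_add hP) starD !(hf_star hP). Qed.

Lemma hf_oppr U V : h U (- V) = - h U V.
Proof.
have -> : - V = V :*r (-1) by rewrite /ract scaleN1r.
by rewrite (hf_mul hP) mulrN1.
Qed.

Lemma hf_oppl U V : h (- U) V = - h U V.
Proof. by rewrite -(hf_star hP) hf_oppr starN (hf_star hP). Qed.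

Lemma hf_sum U n (F : 'I_n -> M) : h U (\sum_k F k) = \sum_k h U (F k).
Proof.
apply: (big_morph (h U)) => [V W|]; first exact: (hf_add hP).
by rewrite -(ract0 0) (hf_mul hP) mulr0.
Qed.

End Form.

(** The difference S of the two connections is A-linear in the module, and
    (d, e, f) |-> h (S_d phi e, phi f) is symmetric in d, e (equal torsions)
    and antisymmetric in e, f (compatibility with h and reality), so it
    equals its own opposite once the two symmetries have been alternated
    three times each. *)
Lemma prc_unique nabla nabla' :
  pseudo_riemannian_calculus h g phi nabla ->
  pseudo_riemannian_calculus h g phi nabla' ->
  forall d U, g d -> nabla' d U = nabla d U.
Proof.
move=> P P' d0 U0 gd0.
have hP := (rmc_metric (prc_rmc P)).1.
have C := prc_connection P; have C' := prc_connection P'.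
pose S d U := nabla' d U - nabla d U.
have SD d U V : g d -> S d (U + V) = S d U + S d V.
  by move=> gd; rewrite /S (ac_add C) // (ac_add C') // opprD addrACA.
have SM d U a : g d -> S d (U :*r a) = S d U :*r a.
  move=> gd; rewrite /S (ac_leibniz C) // (ac_leibniz C') // ractDl.
  by rewrite ractNl opprD addrACA subrr addr0.
have S0 d : g d -> S d 0 = 0.
  by move=> gd; rewrite -(ract0 0) SM // !ract0.
have phig d : g d -> (phi @` g) (phi d) by move=> gd; exists d.
have Ssym d e : g d -> g e -> S d (phi e) = S e (phi d).
  move=> gd ge; rewrite /S.
  have T := subr0_eq (prc_torsion P gd ge).
  have T' := subr0_eq (prc_torsion P' gd ge).
  move: T'; rewrite -T => /eqP; rewrite subr_eq => /eqP ->.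
  by rewrite addrAC [_ - _ - _]addrAC subrr add0r addrC.
have Sskew d e f : g d -> g e -> g f ->
    h (S d (phi e)) (phi f) = - h (S d (phi f)) (phi e).
  move=> gd ge gf; apply/eqP; rewrite -addr_eq0; apply/eqP.
  have hS d' e' f' : g d' -> g e' -> g f' ->
      h (phi f') (S d' (phi e')) = h (S d' (phi e')) (phi f').
    move=> gd' ge' gf'; rewrite -(hf_star hP) /S hf_addl // hf_oppl //.
    rewrite starD starN.
    by rewrite -(prc_real P gd' (phig _ ge') (phig _ gf'))
      -(prc_real P' gd' (phig _ ge') (phig _ gf')).
  rewrite -(hS d f e) // /S hf_addl // hf_oppl // (hf_add hP) hf_oppr //.
  by rewrite addrACA -opprD -(prc_metric P) // -(prc_metric P') // subrr.
have h0 d e f : g d -> g e -> g f -> h (S d (phi e)) (phi f) = 0.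
  move=> gd ge gf; apply: eqN_eq0.
  (* alternate the two symmetries until the arguments are d, e, f again *)
  rewrite {1}Sskew // (Ssym d f) // Sskew // opprK (Ssym f e) // Sskew //.
  by rewrite (Ssym e d).
have Sphi0 d e : g d -> g e -> S d (phi e) = 0.
  move=> gd ge; apply: (rmc_metric (prc_rmc P)).2 => V.
  have [n [F [a [GF ->]]]] := rmc_gen (prc_rmc P) V.
  rewrite hf_sum // big1 // => k _; rewrite (hf_mul hP).
  by have [f gf <-] := GF k; rewrite h0 // mul0r.
apply/subr0_eq; rewrite -/(S d0 U0).
have [n [F [a [GF ->]]]] := rmc_gen (prc_rmc P) U0.
rewrite (big_morph (S d0) (fun U V => SD d0 U V gd0) (S0 _ gd0)) big1 // => k _.
by rewrite SM //; have [f gf <-] := GF k; rewrite Sphi0 // /ract scaler0.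
Qed.

End Uniqueness.

(** * The real centre *)

Section RealCentre.
Variables (R : realType) (A : unitStarAlgType R).

(** The real centre is where all coefficients of the calculus live; packaged
    as a commutative ring with units it makes scalar identities decidable by
    ring normalisation. *)
Definition real_central : {pred A} :=
  fun a => `[< star a = a /\ forall b, a * b = b * a >].

Lemma real_centralP (a : A) :
  reflect (star a = a /\ forall b, a * b = b * a) (a \in real_central).
Proof. exact: asboolP. Qed.

Fact real_central_divring : divring_closed real_central.
Proof.
split=> [|a b|a b].
- by apply/real_centralP; split=> [|b]; rewrite ?star1 // mul1r mulr1.
- move=> /real_centralP[ha ca] /real_centralP[hb cb]; apply/real_centralP.
  by split=> [|c]; rewrite ?starD ?starN ?ha ?hb // mulrBl mulrBr ca cb.
- move=> /real_centralP[ha ca] /real_centralP[hb cb].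
  have cVb c : b^-1 * c = c * b^-1.
    by apply/esym/(@commrV A c b)/esym/cb.
  apply/real_centralP; split=> [|c]; last by rewrite -mulrA cVb !mulrA ca.
  rewrite starM ha -ca; congr (_ * _).
  have [ub|nub] := boolP (b \is a GRing.unit); last by rewrite invr_out.
  apply: (mulrI ub); rewrite divrr // -{1}hb -starM.
  by rewrite -star1 -(divrr ub) cb.
Qed.

HB.instance Definition _ :=
  GRing.isDivringClosed.Build A real_central real_central_divring.

Record rcentre := RCentre { rcval :> A; rcvalP : rcval \in real_central }.
HB.instance Definition _ := [isSub for rcval].
HB.instance Definition _ := [Choice of rcentre by <:].
HB.instance Definition _ := [SubChoice_isSubUnitRing of rcentre by <:].

Fact rcentre_mulC (a b : rcentre) : a * b = b * a.
Proof.
apply: val_inj; rewrite !rmorphM /=.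
by have /real_centralP[_] := rcvalP a.
Qed.

HB.instance Definition _ :=
  GRing.PzRing_hasCommutativeMul.Build rcentre rcentre_mulC.

End RealCentre.
Arguments real_central {R A}.

Section RealCentreTheory.
Variables (R : realType) (A : unitStarAlgType R).
Implicit Types a b : rcentre A.

HB.instance Definition _ :=
  GRing.RMorphism.copy (@rcval R A) (val : rcentre A -> A).

Lemma rcval_star a : star (rcval a) = rcval a.
Proof. by have /real_centralP[] := rcvalP a. Qed.

Lemma rcvalC a (b : A) : rcval a * b = b * rcval a.
Proof. by have /real_centralP[_] := rcvalP a. Qed.

Lemma rcval_unit a : (rcval a \is a GRing.unit) = (a \is a GRing.unit).
Proof. by []. Qed.

(** Differentiate a b = b a in the direction d. *)
Lemma der_real_central (d : A -> A) a :
  hermitian_derivation d -> d (rcval a) \in real_central.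
Proof.
move=> dP; apply/real_centralP; split=> [|b].
  by rewrite -(der_star dP) rcval_star.
apply: (addIr (rcval a * d b)).
by rewrite -(derM dP) (rcvalC a b) (derM dP) (rcvalC a) addrC.
Qed.

Lemma rcentre_two_unit : (2 : rcentre A) \is a GRing.unit.
Proof.
rewrite -rcval_unit (_ : rcval 2 = 2) //; apply/unitrP.
have two : (2 : R[i]) *: (1 : A) = 2 by rewrite scaler_nat.
exists (2^-1 *: 1); rewrite -scalerAl -scalerAr mul1r mulr1 -two.
by rewrite scalerA mulVf ?pnatr_eq0 // scale1r.
Qed.

(** The element 2 alpha k is central, being the derivative of a central
    element; since k is central and regular it can be cancelled from
    2 alpha k y = y 2 alpha k. *)
Lemma log_der_central (d : A -> A) (k : rcentre A) alpha :
  hermitian_derivation d -> GRing.rreg (rcval k) ->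
  d (rcval k) = 2 * alpha * rcval k -> star alpha = alpha ->
  alpha \in real_central.
Proof.
move=> dP kreg dk alphaH; apply/real_centralP; split=> // y; apply: kreg.
apply: (mulrI (rcentre_two_unit : (2 : A) \is a GRing.unit)).
have /real_centralP[_ /(_ y)] := der_real_central k dP.
rewrite dk -[in RHS]mulrA => e.
transitivity (2 * alpha * rcval k * y); first by rewrite -!mulrA rcvalC !mulrA.
rewrite e !mulrA; congr (_ * _ * _).
by rewrite mulr_natl mulr_natr.
Qed.

End RealCentreTheory.

Section DerivationModule.
Variables (R : realType) (A : unitStarAlgType R).

Lemma der_scale (k : rcentre A) d :
  hermitian_derivation d -> hermitian_derivation (fun u => rcval k * d u).
Proof.
move=> dP; split; first split.
- by move=> c a b; rewrite (derD dP) (derZ dP) mulrDr scalerAr.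
- move=> a b; rewrite (derM dP) mulrDr !mulrA; congr (_ + _).
  by rewrite (rcvalC k a).
- by move=> a; rewrite (der_star dP) starM rcval_star rcvalC.
Qed.

Lemma der_zero : hermitian_derivation (fun=> 0 : A).
Proof.
split; first split; first by move=> c a b; rewrite scaler0 addr0.
  by move=> a b; rewrite mul0r mulr0 addr0.
by move=> a; rewrite star0.
Qed.

Lemma der_add (d e : A -> A) :
  hermitian_derivation d -> hermitian_derivation e ->
  hermitian_derivation (d \+ e).
Proof.
move=> dP eP; split; first split.
- move=> c a b /=; rewrite (derD dP) (derD eP) (derZ dP) (derZ eP) scalerDr.
  by rewrite addrACA.
- by move=> a b /=; rewrite (derM dP) (derM eP) mulrDl mulrDr addrACA.
- by move=> a /=; rewrite (der_star dP) (der_star eP) starD.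
Qed.

Lemma der_lie (d e : A -> A) :
  hermitian_derivation d -> hermitian_derivation e ->
  hermitian_derivation (lie_bracket d e).
Proof.
move=> dP eP; rewrite /lie_bracket; split; first split.
- move=> c a b; rewrite !(derD dP, derD eP, derZ dP, derZ eP).
  by rewrite scalerBr opprD addrACA.
- move=> a b; rewrite !(derM eP, derM dP, derD eP, derD dP) mulrBl mulrBr.
  move: (d (e a) * b) (e a * d b) (d a * e b) (a * d (e b)) => p1 p2 p3 p4.
  move: (e (d a) * b) (a * e (d b)) => q1 q4.
  rewrite [p3 + p4]addrC [p2 + q4]addrC.
  rewrite [p1 + p2 + _]addrACA [q1 + p3 + _]addrACA.
  by rewrite [p3 + p2]addrC opprD [LHS]addrACA subrr addr0 opprD addrACA.
- move=> a; rewrite (der_star eP) (der_star dP) (der_star dP) (der_star eP).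
  by rewrite starD starN.
Qed.

Variable n : nat.
Implicit Types (k l : 'I_n -> rcentre A) (D : 'I_n -> A -> A).

Definition der_comb D k (u : A) : A := \sum_a rcval (k a) * D a u.

Lemma der_comb_herm D k :
  (forall a, hermitian_derivation (D a)) -> hermitian_derivation (der_comb D k).
Proof.
move=> DP; rewrite /der_comb; elim: (index_enum _) => [|a r IHr].
  by under eq_fun do rewrite big_nil; apply: der_zero.
under eq_fun do rewrite big_cons.
by apply: der_add => //; apply: der_scale.
Qed.

(** The terms in which both coefficients stay undifferentiated contribute the
    brackets of the D a, because these coefficients are central. *)
Lemma lie_der_comb D (f : 'I_n -> 'I_n -> 'I_n -> rcentre A) k l u :
  (forall a, hermitian_derivation (D a)) ->
  (forall a b u, lie_bracket (D a) (D b) u = \sum_c rcval (f a b c) * D c u) ->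
  lie_bracket (der_comb D k) (der_comb D l) u =
  \sum_c (der_comb D k (rcval (l c)) - der_comb D l (rcval (k c))
    + \sum_a \sum_b rcval (k a) * rcval (l b) * rcval (f a b c)) * D c u.
Proof.
move=> DP Df.
have comp k' l' : der_comb D k' (der_comb D l' u) =
    \sum_c der_comb D k' (rcval (l' c)) * D c u
    + \sum_a \sum_b rcval (k' a) * rcval (l' b) * D a (D b u).
  rewrite {2}/der_comb (der_sum (der_comb_herm k' DP)).
  rewrite [X in _ = _ + X]exchange_big -big_split.
  apply: eq_bigr => b _; rewrite (derM (der_comb_herm k' DP)); congr (_ + _).
  rewrite mulr_sumr; apply: eq_bigr => a _.
  by rewrite mulrA (rcvalC (l' b)).
rewrite /lie_bracket !comp opprD addrACA -sumrB.
under [RHS]eq_bigr do rewrite mulrDl mulrBl.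
rewrite [RHS]big_split /=; congr (_ + _).
rewrite [X in _ - X]exchange_big -sumrB.
under [RHS]eq_bigr do rewrite mulr_suml.
rewrite [RHS]exchange_big; apply: eq_bigr => a _.
under [RHS]eq_bigr do rewrite mulr_suml.
rewrite [RHS]exchange_big -sumrB; apply: eq_bigr => b _.
rewrite [rcval (l b) * _]rcvalC -mulrBr [X in _ * X](Df a b u) mulr_sumr.
by apply: eq_bigr => c _; rewrite mulrA.
Qed.

End DerivationModule.

Section CentreDerivation.
Variables (R : realType) (A : unitStarAlgType R) (d : A -> A).
Hypothesis dP : hermitian_derivation d.
Local Notation K := (rcentre A).

(** The derivation induced on the real centre, as an operation of that
    commutative ring. *)
Definition rcder (k : K) : K := RCentre (der_real_central k dP).

Lemma rcderD k l : rcder (k + l) = rcder k + rcder l.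
Proof. by apply: val_inj; apply: (derD dP). Qed.

Lemma rcderN k : rcder (- k) = - rcder k.
Proof. by apply: val_inj; apply: (derN dP). Qed.

Lemma rcderM k l : rcder (k * l) = rcder k * l + k * rcder l.
Proof. by apply: val_inj; apply: (derM dP). Qed.

Lemma rcder0 : rcder 0 = 0.
Proof. by apply: val_inj; apply: (der0 dP). Qed.

Lemma rcder1 : rcder 1 = 0.
Proof. by apply: val_inj; apply: (der1 dP). Qed.

End CentreDerivation.

(** * The connection of an orthogonal frame *)

Section Frame.
Variables (R : realType) (A : starAlgType R) (M : lmodType A^c) (n : nat).

Record frame (E : 'I_n -> M) (x : M -> 'I_n -> A) : Prop := {
  frame_sum : forall U, \sum_a E a :*r x U a = U;
  frame_coord : forall c a, x (\sum_b E b :*r c b) a = c a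
}.

Variables (E : 'I_n -> M) (x : M -> 'I_n -> A).
Hypothesis xP : frame E x.

Lemma coord_add U V a : x (U + V) a = x U a + x V a.
Proof.
rewrite -{1}(frame_sum xP U) -{1}(frame_sum xP V) -big_split /=.
under eq_bigr do rewrite -ractDr.
by rewrite (frame_coord xP (fun b => x U b + x V b)).
Qed.

Lemma coord_ract U c a : x (U :*r c) a = x U a * c.
Proof.
rewrite -{1}(frame_sum xP U) ract_suml.
under eq_bigr do rewrite ractA.
by rewrite (frame_coord xP (fun b => x U b * c)).
Qed.

Lemma coord_frame b a : x (E b) a = (b == a)%:R.
Proof.
have {1}-> : E b = \sum_c E c :*r (b == c)%:R.
  rewrite (bigD1 b) //= eqxx ract1 big1 ?addr0 // => c.
  by rewrite eq_sym => /negbTE ->; rewrite ract0.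
by rewrite (frame_coord xP (fun c => (b == c)%:R)).
Qed.

Lemma coord_opp U a : x (- U) a = - x U a.
Proof. by rewrite -[U]ract1 -ractNr !coord_ract mulrN. Qed.

Lemma coord_inj U V : (forall a, x U a = x V a) -> U = V.
Proof.
move=> UV; rewrite -(frame_sum xP U) -(frame_sum xP V).
by apply: eq_bigr => a _; rewrite UV.
Qed.

End Frame.

Section Koszul.
Variables (K : comUnitRingType) (n : nat).
Variables (eta : 'I_n -> K) (Deta : 'I_n -> 'I_n -> K).
Variable f : 'I_n -> 'I_n -> 'I_n -> K.

Hypothesis two_unit : (2 : K) \is a GRing.unit.
Hypothesis eta_unit : forall a, eta a \is a GRing.unit.
Hypothesis fN : forall a b c, f a b c = - f b a c.

(** Twice the lowered connection symbol h (nabla_a E_b, E_c) given by Koszul's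
    formula, where eta a is the square norm of E_a, Deta a b is the derivative
    of eta b along the a-th field and f are the structure constants. *)
Definition koszul (a b c : 'I_n) : K :=
  Deta a b *+ (b == c) + Deta b a *+ (a == c) - Deta c a *+ (a == b)
  + eta c * f a b c - eta b * f a c b - eta a * f b c a.

Definition christoffel (a b c : 'I_n) : K :=
  2^-1 * (eta c)^-1 * koszul a b c.

Lemma christoffel_lower a b c : 2 * (eta c * christoffel a b c) = koszul a b c.
Proof.
have e2 : (2 : K) * 2^-1 = 1 by rewrite divrr.
have ec : eta c * (eta c)^-1 = 1 by rewrite divrr.
rewrite /christoffel; ring: e2 ec.
Qed.

(** An identity for a raised symbol is checked after clearing the
    denominators eta c and 2. *)
Lemma christoffel_eq a b c y :
  2 * (eta c * y) = koszul a b c -> christoffel a b c = y.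
Proof.
move=> e; apply: (mulrI (eta_unit c)); apply: (mulrI two_unit).
by rewrite christoffel_lower.
Qed.

(** Exchanging b and c in Koszul's formula and adding cancels all terms except
    the derivative of the metric, as f is antisymmetric in its first two
    arguments. *)
Lemma christoffel_metric a b c :
  eta c * christoffel a b c + eta b * christoffel a c b =
  Deta a b *+ (b == c).
Proof.
apply: (mulrI two_unit); rewrite mulrDr !christoffel_lower /koszul.
rewrite (fN c b) (eq_sym c b); case: (eqVneq b c) => [->|_] /=.
  by ring.
by rewrite !mulr0n; ring.
Qed.

(** The derivative terms are symmetric in a and b, and so is the sum of the last
    two structure terms. *)
Lemma christoffel_torsion a b c :
  christoffel a b c - christoffel b a c = f a b c.
Proof.
apply: (mulrI two_unit); apply: (mulrI (eta_unit c)).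
rewrite !mulrBr ![eta c * (2 * _)]mulrCA !christoffel_lower /koszul.
rewrite (fN b a) (eq_sym b a); case: (eqVneq a b) => [->|_] /=.
  by ring.
by rewrite !mulr0n; ring.
Qed.

End Koszul.

Section ConformalMetric.
Variables (R : realType) (A : unitStarAlgType R) (n : nat).
Local Notation K := (rcentre A).
Variables (D : 'I_n -> A -> A) (DP : forall a, hermitian_derivation (D a)).
Variables (eta : 'I_n -> K) (lambda : 'I_n -> 'I_n -> K).
Variable f : 'I_n -> 'I_n -> 'I_n -> K.
Variables (delta : K) (alpha : 'I_n -> K).
Hypothesis eta_unit : forall a, eta a \is a GRing.unit.
Hypothesis fN : forall a b c, f a b c = - f b a c.
Hypothesis Deta : forall a b, rcder (DP a) (eta b) = 2 * lambda a b * eta b.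
Hypothesis Ddelta : forall a, rcder (DP a) delta = 2 * alpha a * delta.

(** The factor delta of the square norms delta * eta b is left out: it divides
    out of Koszul's formula, so that it never has to be inverted.  Here lambda
    is the table of half logarithmic derivatives of eta. *)
Definition conformal_der (a b : 'I_n) : K := 2 * (alpha a + lambda a b) * eta b.

Local Notation Gamma := (christoffel eta conformal_der f).

Lemma conformal_metric a b c :
  rcval (delta * eta c * Gamma a b c + delta * eta b * Gamma a c b) =
  D a (rcval (delta * eta b)) *+ (b == c).
Proof.
have -> : D a (rcval (delta * eta b)) = rcval (delta * conformal_der a b).
  rewrite -[LHS]/(rcval (rcder (DP a) (delta * eta b))); congr rcval.
  by rewrite rcderM Ddelta Deta /conformal_der; ring.
have -> : rcval (delta * conformal_der a b) *+ (b == c) =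
    rcval (delta * (conformal_der a b *+ (b == c))).
  by case: eqP => _; rewrite /= ?mulr0n ?mulr0.
congr rcval; rewrite -!mulrA -mulrDr; congr (_ * _).
exact: (christoffel_metric _ (rcentre_two_unit A) eta_unit fN).
Qed.

Lemma conformal_torsion a b c : Gamma a b c - Gamma b a c = f a b c.
Proof. exact: (christoffel_torsion _ (rcentre_two_unit A) eta_unit fN). Qed.

End ConformalMetric.

Section Existence.
Variables (R : realType) (A : unitStarAlgType R) (M : lmodType A^c) (n : nat).
Variables (E : 'I_n -> M) (x : M -> 'I_n -> A) (h : M -> M -> A).
Variables (g : set (A -> A)) (phi : (A -> A) -> M) (D : 'I_n -> A -> A).
Variables (eta : 'I_n -> rcentre A) (Gamma : 'I_n -> 'I_n -> 'I_n -> rcentre A).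

Hypothesis xP : frame E x.
Hypothesis hE : forall U V, h U V = \sum_a star (x U a) * rcval (eta a) * x V a.
Hypothesis eta_reg : forall a, GRing.lreg (rcval (eta a)).
Hypothesis gP : real_lie_algebra g.
Hypothesis phiP : real_linear_on g phi.
Hypothesis gD : forall a, g (D a).
Hypothesis phiD : forall a, phi (D a) = E a.
(* The coordinates of phi d are at the same time the coefficients of d over the
   D a, so a term linear in phi d accounts for the derivatives along d. *)
Hypothesis anchor : forall d, g d -> exists c : 'I_n -> rcentre A,
  (forall a, x (phi d) a = rcval (c a)) /\
  (forall u, d u = \sum_a rcval (c a) * D a u).
Hypothesis phi_bracket : forall d1 d2 c, g d1 -> g d2 ->
  x (phi (lie_bracket d1 d2)) c =
    d1 (x (phi d2) c) - d2 (x (phi d1) c)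
    + \sum_a \sum_b x (phi d1) a * x (phi d2) b
        * rcval (Gamma a b c - Gamma b a c).
Hypothesis Gamma_metric : forall a b c,
  rcval (eta c * Gamma a b c + eta b * Gamma a c b) =
  D a (rcval (eta b)) *+ (b == c).

Definition connection_form (d : A -> A) (b c : 'I_n) : A :=
  \sum_a x (phi d) a * rcval (Gamma a b c).

(** The coordinate formula for the covariant derivative.  Its value at d uses
    only d and phi d, hence does not depend on how d is presented as a
    combination of generators of g. *)
Definition frame_connection (d : A -> A) (U : M) : M :=
  \sum_c E c :*r (d (x U c) + \sum_b connection_form d b c * x U b).

Local Notation nabla := frame_connection.
Let herm := rla_herm gP.

Lemma coord_connection d U c :
  x (nabla d U) c = d (x U c) + \sum_b connection_form d b c * x U b.
Proof.
by rewrite (frame_coord xP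
  (fun c => d (x U c) + \sum_b connection_form d b c * x U b)).
Qed.

Lemma frame_connectionE a b :
  nabla (D a) (E b) = \sum_c E c :*r rcval (Gamma a b c).
Proof.
apply: (coord_inj xP) => c.
rewrite coord_connection (frame_coord xP (fun c => rcval (Gamma a b c))).
have DP := herm (gD a).
have -> : D a (x (E b) c) = 0.
  by rewrite (coord_frame xP); case: eqP => _; rewrite ?(der1 DP) ?(der0 DP).
rewrite add0r (bigD1 b) //= (coord_frame xP) eqxx mulr1.
rewrite big1 ?addr0 => [|e /negbTE eb]; last first.
  by rewrite (coord_frame xP) eq_sym eb mulr0.
rewrite /connection_form phiD (bigD1 a) //= (coord_frame xP) eqxx mul1r.
rewrite big1 ?addr0 // => e /negbTE ea.
by rewrite (coord_frame xP) eq_sym ea mul0r.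
Qed.

Lemma frame_connection_scaled (k : rcentre A) d e U :
  (forall u, d u = rcval k * e u) -> phi d = phi e :*r rcval k ->
  nabla d U = nabla e U :*r rcval k.
Proof.
move=> de phide; apply: (coord_inj xP) => c.
rewrite (coord_ract xP) !coord_connection de rcvalC mulrDl; congr (_ + _).
rewrite mulr_suml; apply: eq_bigr => b _; rewrite -mulrA -rcvalC mulrA.
congr (_ * _); rewrite mulr_suml; apply: eq_bigr => a _.
by rewrite phide (coord_ract xP) -mulrA rcvalC mulrA.
Qed.

Lemma frame_hermitian_form : hermitian_form h.
Proof.
split=> [U V W|U V a|U V]; rewrite !hE.
- by rewrite -big_split; apply: eq_bigr => a _; rewrite (coord_add xP) mulrDr.
- by rewrite mulr_suml; apply: eq_bigr => b _; rewrite (coord_ract xP) mulrA.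
- rewrite (big_morph star (@starD _ A) (@star0 _ A)); apply: eq_bigr => a _.
  by rewrite !starM starK rcval_star mulrA.
Qed.

Lemma frame_metric : metric h.
Proof.
split=> [|U hU0]; first exact: frame_hermitian_form.
apply: (coord_inj xP) => a.
suff /eta_reg/(can_inj (@starK _ A)) :
  rcval (eta a) * star (x U a) = rcval (eta a) * star (x 0 a) by [].
have -> : x 0 a = 0 by rewrite -(ract0 0) (coord_ract xP) mulr0.
rewrite star0 mulr0 -(hU0 (E a)) hE (bigD1 a) //= (coord_frame xP) eqxx mulr1.
rewrite rcvalC big1 ?addr0 // => b /negbTE ba.
by rewrite (coord_frame xP) eq_sym ba mulr0.
Qed.

Lemma form_real_central U V :
  (forall a, x U a \in real_central) -> (forall a, x V a \in real_central) ->
  h U V \in real_central.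
Proof.
move=> rU rV; rewrite hE; apply: rpred_sum => a _.
have /real_centralP[-> _] := rU a.
by rewrite !rpredM // rcvalP.
Qed.

Lemma coord_phi d a : g d -> x (phi d) a \in real_central.
Proof. by move=> /anchor[c [-> _]]; apply: rcvalP. Qed.

Lemma frame_calculus : real_metric_calculus h g phi.
Proof.
split=> //; first exact: frame_metric.
- move=> U; exists n, E, (x U); split; last by rewrite (frame_sum xP).
  by move=> a; exists (D a).
- move=> _ _ [d gd <-] [e ge <-].
  have /real_centralP[] // : h (phi d) (phi e) \in real_central.
  by apply: form_real_central => a; apply: coord_phi.
Qed.

Lemma frame_affine_connection : affine_connection g nabla.
Proof.
split=> [d U V gd|U|d U a gd].
- have dP := herm gd; apply: (coord_inj xP) => c.
  rewrite (coord_add xP) !coord_connection (coord_add xP) (derD dP).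
  rewrite addrACA -big_split; congr (_ + _); apply: eq_bigr => b _.
  by rewrite (coord_add xP) mulrDr.
- split=> [d1 d2 g1 g2|r d gd]; apply: (coord_inj xP) => c.
    rewrite (coord_add xP) !coord_connection addrACA -big_split /=.
    congr (_ + _); apply: eq_bigr => b _; rewrite -mulrDl -big_split /=.
    congr (_ * _); apply: eq_bigr => a _.
    by rewrite phiP.1 // (coord_add xP) mulrDl.
  rewrite (coord_ract xP) !coord_connection mulr_algr scalerDr scaler_sumr.
  congr (_ + _); apply: eq_bigr => b _.
  rewrite scalerAl scaler_sumr; congr (_ * _); apply: eq_bigr => a _.
  by rewrite phiP.2 // (coord_ract xP) mulr_algr scalerAl.
- have dP := herm gd; apply: (coord_inj xP) => c.
  rewrite (coord_add xP) !(coord_ract xP) !coord_connection (coord_ract xP).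
  rewrite (derM dP) mulrDl addrAC mulr_suml; congr (_ + _ + _).
  by apply: eq_bigr => b _; rewrite (coord_ract xP) mulrA.
Qed.

Lemma connection_form_real d b c :
  g d -> connection_form d b c \in real_central.
Proof.
move=> gd; apply: rpred_sum => a _.
by rewrite rpredM ?coord_phi ?rcvalP.
Qed.

(** The connection form is skew up to the derivative of the metric, for every d
    in g and not only for the D a: both sides are linear in the coordinates
    of phi d. *)
Lemma connection_form_metric d b c : g d ->
  rcval (eta c) * connection_form d b c
  + rcval (eta b) * connection_form d c b =
  d (rcval (eta b)) *+ (b == c).
Proof.
move=> /anchor[k [xk ->]]; rewrite -sumrMnl !mulr_sumr -big_split.
apply: eq_bigr => a _; rewrite xk -mulrnAr -Gamma_metric mulrDr /=.
rewrite ![rcval _ * (rcval (k a) * _)]mulrA ![rcval _ * rcval (k a)]rcvalC.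
by rewrite -!mulrA.
Qed.

Lemma frame_connection_metric d U V : g d ->
  d (h U V) = h (nabla d U) V + h U (nabla d V).
Proof.
move=> gd; have dP := herm gd; rewrite !hE (der_sum dP).
pose G := connection_form d.
have starG b c : star (G b c) = G b c.
  by have /real_centralP[] := connection_form_real b c gd.
have GC b c u : G b c * u = u * G b c.
  by have /real_centralP[] := connection_form_real b c gd.
have -> : \sum_a star (x (nabla d U) a) * rcval (eta a) * x V a =
  \sum_a star (d (x U a)) * rcval (eta a) * x V a
  + \sum_b \sum_a star (x U b) * (rcval (eta a) * G b a) * x V a.
  rewrite exchange_big -big_split; apply: eq_bigr => a _ /=.
  rewrite coord_connection starD !mulrDl; congr (_ + _).
  rewrite (big_morph star (@starD _ A) (@star0 _ A)) !mulr_suml.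
  by apply: eq_bigr => b _; rewrite starM starG rcvalC mulrA.
have -> : \sum_a star (x U a) * rcval (eta a) * x (nabla d V) a =
  \sum_a star (x U a) * rcval (eta a) * d (x V a)
  + \sum_b \sum_a star (x U b) * (rcval (eta b) * G a b) * x V a.
  rewrite -big_split; apply: eq_bigr => a _ /=.
  rewrite coord_connection !mulrDr; congr (_ + _).
  by rewrite mulr_sumr; apply: eq_bigr => b _; rewrite !mulrA.
rewrite addrACA -!big_split /=; apply: eq_bigr => b _.
rewrite !(derM dP) (der_star dP) mulrDl addrAC; congr (_ + _ + _).
rewrite -big_split (bigD1 b) //= big1 ?addr0 => [|a /negbTE ab].
  by rewrite -mulrDl -mulrDr connection_form_metric // eqxx.
by rewrite -mulrDl -mulrDr connection_form_metric // eq_sym ab mulr0 mul0r.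
Qed.

Lemma frame_connection_torsion d1 d2 : g d1 -> g d2 ->
  nabla d1 (phi d2) - nabla d2 (phi d1) - phi (lie_bracket d1 d2) = 0.
Proof.
move=> g1 g2; apply/eqP; rewrite subr_eq0; apply/eqP.
apply: (coord_inj xP) => c.
rewrite phi_bracket // (coord_add xP) (coord_opp xP).
rewrite !coord_connection opprD addrACA; congr (_ + _).
have expand d e : \sum_b connection_form d b c * x (phi e) b =
    \sum_b \sum_a x (phi d) a * rcval (Gamma a b c) * x (phi e) b.
  by apply: eq_bigr => b _; rewrite mulr_suml.
rewrite !expand [X in X - _]exchange_big -sumrB; apply: eq_bigr => a _ /=.
rewrite -sumrB; apply: eq_bigr => b _.
have /real_centralP[_ xC] := coord_phi a g1.
rewrite mulrBr; congr (_ - _).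
  by rewrite -mulrA rcvalC mulrA.
by rewrite -[in RHS]mulrA xC -mulrA; congr (_ * _); rewrite rcvalC.
Qed.

Theorem frame_connection_calculus : pseudo_riemannian_calculus h g phi nabla.
Proof.
split.
- exact: frame_calculus.
- exact: frame_affine_connection.
- move=> d _ _ gd [e1 g1 <-] [e2 g2 <-].
  have /real_centralP[-> //] : h (nabla d (phi e1)) (phi e2) \in real_central.
  apply: form_real_central => a; last exact: coord_phi.
  rewrite coord_connection rpredD //.
    by have [k [-> _]] := anchor g1; apply/der_real_central/herm.
  by apply: rpred_sum => b _; rewrite rpredM ?connection_form_real ?coord_phi.
- exact: frame_connection_metric.
- exact: frame_connection_torsion.
Qed.

End Existence.

(** * The noncommutative four-sphere and its frame *)

Section RealImaginaryParts.
Variables (R : realType) (A : unitStarAlgType R) (Z : A).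
Hypothesis ZC : Z * star Z = star Z * Z.

Let P : A := 2^-1 *: (Z + star Z).
Let Q : A := (2 * 'i%C)^-1 *: (Z - star Z).

Lemma re_star : star P = P.
Proof.
rewrite /P starZ starD starK addrC; congr (_ *: _).
by rewrite fmorphV rmorph_nat.
Qed.

Lemma im_star : star Q = Q.
Proof.
rewrite /Q starZ starD starN starK -opprB scalerN -scaleNr; congr (_ *: _).
have conj2i : (2 * 'i%C)^*%C = - (2 * 'i%C) :> R[i].
  by rewrite -(rmorph_nat (real_complex R)); simpc.
by rewrite conjc_inv conj2i invrN opprK.
Qed.

Lemma re_im_comm : P * Q = Q * P.
Proof.
rewrite /P /Q -!scalerAl -!scalerAr !scalerA mulrC; congr (_ *: _).
have ZcS : GRing.comm Z (star Z) by [].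
by apply: commrB; apply/commr_sym/commrD => //; apply: commr_sym.
Qed.

Lemma re_im_sqr : P * P + Q * Q = Z * star Z.
Proof.
have i2 : (2 * 'i%C)^-1 * (2 * 'i%C)^-1 = - (2^-1 * 2^-1) :> R[i].
  rewrite invfM mulrACA -['i%C^-1 * _]invfM ['i%C * _]sqr_i.
  by rewrite invrN invr1 mulrN1.
rewrite /P /Q -!scalerAl -!scalerAr !scalerA i2 scaleNr -scalerBr.
rewrite !(mulrDl, mulrDr, mulrN, mulNr) -ZC !opprD !opprK.
move: (Z * Z) (Z * star Z) (star Z * star Z) => a b c.
rewrite addrACA [a + b + _]addrACA subrr add0r [b + c + _]addrACA subrr addr0.
have -> : b + b + (b + b) = (2 * 2 : R[i]) *: b.
  by rewrite -scalerA !scaler_nat !mulr2n.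
by rewrite scalerA mulrACA mulVf ?pnatr_eq0 // mul1r scale1r.
Qed.

(** The pair (P k - Q l, Q k + P l) is the real form of (P + i Q) (k + i l),
    so the mixed terms cancel because P and Q commute. *)
Lemma re_im_form (k l k' l' : rcentre A) :
  star (P * rcval k - Q * rcval l) * (P * rcval k' - Q * rcval l')
  + star (Q * rcval k + P * rcval l) * (Q * rcval k' + P * rcval l')
  = Z * star Z * (rcval k * rcval k' + rcval l * rcval l').
Proof.
have comb (X Y : A) (a b : rcentre A) :
    X * rcval a * (Y * rcval b) = X * Y * (rcval a * rcval b).
  by rewrite -mulrA [rcval a * _]mulrA (rcvalC a) -!mulrA.
have herm (X : A) (a : rcentre A) :
    star X = X -> star (X * rcval a) = X * rcval a.
  by move=> hX; rewrite starM rcval_star hX rcvalC.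
rewrite !starD starN !herm ?re_star ?im_star //.
rewrite !(mulrDl, mulrDr, mulrN, mulNr) !comb -re_im_comm.
rewrite -re_im_sqr !(mulrDl, mulrDr) opprK.
move: (P * P * (_ * _)) (P * Q * (_ * _)) (P * Q * (_ * _)) => a b c.
move: (Q * Q * (_ * _)) (Q * Q * (_ * _)) (P * P * (_ * _)) => d e f.
rewrite addrACA [a - c + _]addrACA addNr addr0 [- b + _ + _]addrACA addNr add0r.
by rewrite [e + f]addrC.
Qed.

End RealImaginaryParts.

Section SphereAlgebra.
Variables (R : realType) (theta : R).
Local Notation A := (S4loc theta).
Local Notation K := (rcentre A).
Local Notation loc := (to_loc (s4_mset theta)).

Lemma to_locM a b : loc (a * b) = loc a * loc b.
Proof. by rewrite /to_loc fracM denM1. Qed.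

Lemma to_locD a b : loc (a + b) = loc a + loc b.
Proof. by rewrite /to_loc fracD. Qed.

Lemma to_locN a : loc (- a) = - loc a.
Proof. by rewrite /to_loc fracN. Qed.

Lemma to_locZ (c : R[i]) a : loc (c *: a) = c *: loc a.
Proof. by rewrite /to_loc [RHS]fracZ. Qed.

Lemma to_loc_star a : loc (star a) = star (loc a).
Proof. by rewrite /to_loc [RHS]frac_star. Qed.

Lemma to_loc1 : loc 1 = 1.
Proof. by []. Qed.

Lemma to_loc_frac a (s : den (s4_mset theta)) :
  loc (sval s) * Defs.frac a s = loc a.
Proof. by rewrite fracM; apply: frac_ext; rewrite /= !mul1r. Qed.

Lemma to_loc_real_central c : (forall b, c * b = b * c) -> star c = c ->
  loc c \in real_central.
Proof.
move=> cC cH; apply/real_centralP; split; first by rewrite -to_loc_star cH.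
by elim/fracW=> b s; rewrite !fracM cC denMC.
Qed.

Lemma Z2E : Z2 = loc (s4Z theta * star (s4Z theta)).
Proof. by rewrite to_locM to_loc_star. Qed.

Lemma W2E : W2 = loc (s4W theta * star (s4W theta)).
Proof. by rewrite to_locM to_loc_star. Qed.

Fact Tl_real_central : Tl \in (real_central : {pred A}).
Proof. apply: to_loc_real_central; [exact: s4T_central|exact: s4Ts]. Qed.

Fact Z2_real_central : Z2 \in (real_central : {pred A}).
Proof.
rewrite Z2E; apply: to_loc_real_central; first exact: s4Z2_central.
by rewrite starM starK.
Qed.

Fact W2_real_central : W2 \in (real_central : {pred A}).
Proof.
rewrite W2E; apply: to_loc_real_central; first exact: s4W2_central.
by rewrite starM starK.
Qed.

Definition rcT : K := RCentre Tl_real_central.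
Definition rcZ2 : K := RCentre Z2_real_central.
Definition rcW2 : K := RCentre W2_real_central.
Definition rcS : K := 1 - rcT ^+ 2.

Lemma sphere_relation : rcZ2 + rcW2 + rcT ^+ 2 = 1.
Proof.
apply: val_inj; rewrite /= Z2E W2E -to_locM -!to_locD.
by rewrite s4_sphere.
Qed.

Lemma rcZ2_unit : rcZ2 \is a GRing.unit.
Proof.
rewrite -rcval_unit /= Z2E.
exact: (to_loc_unit (@mkden _ _ (s4_mset theta) _ (ms_Z2 theta))).
Qed.

Lemma rcW2_unit : rcW2 \is a GRing.unit.
Proof.
rewrite -rcval_unit /= W2E.
exact: (to_loc_unit (@mkden _ _ (s4_mset theta) _ (ms_W2 theta))).
Qed.

Lemma rcS_val : rcval rcS = 1 - Tl ^+ 2.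
Proof. by []. Qed.

Lemma rcS_unit : rcS \is a GRing.unit.
Proof.
rewrite -rcval_unit rcS_val -to_loc1 /Tl expr2 -to_locM -to_locN -to_locD.
exact: (to_loc_unit (@mkden _ _ (s4_mset theta) _ (ms_1BT2 theta))).
Qed.

Lemma Zl_normal : Zl * star Zl = star Zl * (Zl : A).
Proof. by rewrite -to_loc_star -!to_locM s4ZZs. Qed.

Lemma Wl_normal : Wl * star Wl = star Wl * (Wl : A).
Proof. by rewrite -to_loc_star -!to_locM s4WWs. Qed.

(** On the image of the sphere algebra this is an induction on terms; on
    fractions, differentiate s * (a / s) = a and cancel the unit s. *)
Lemma der_ext (d e : A -> A) :
  hermitian_derivation d -> hermitian_derivation e ->
  d Zl = e Zl -> d Wl = e Wl -> d Tl = e Tl -> forall u, d u = e u.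
Proof.
move=> dP eP eZ eW eT.
have on_terms a : d (loc (s4_class theta a)) = e (loc (s4_class theta a)).
  elim: a => [|||||a IHa b IHb|a IHa|a IHa b IHb|c a IHa|a IHa] //.
  - by rewrite s4_zeroE [loc 0]frac0 (der0 dP) (der0 eP).
  - by rewrite s4_oneE (der1 dP) (der1 eP).
  - by rewrite s4E to_locD (derD dP) (derD eP) IHa IHb.
  - by rewrite s4E to_locN (derN dP) (derN eP) IHa.
  - by rewrite s4E to_locM (derM dP) (derM eP) IHa IHb.
  - by rewrite s4E to_locZ (derZ dP) (derZ eP) IHa.
  - by rewrite s4E to_loc_star (der_star dP) (der_star eP) IHa.
have on_loc a : d (loc a) = e (loc a) by elim/s4_classW: a.
elim/fracW=> a s; apply: (mulrI (to_loc_unit s)).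
apply: (addrI (d (loc (sval s)) * Defs.frac a s)).
by rewrite -(derM dP) to_loc_frac !on_loc -(derM eP) to_loc_frac.
Qed.

End SphereAlgebra.
Lemma ord4_ind (P : 'I_4 -> Prop) : P 0 -> P 1 -> P 2 -> P 3 -> forall a, P a.
Proof.
move=> P0 P1 P2 P3 [[|[|[|[|//]]]] a4].
- by rewrite (_ : Ordinal a4 = 0) //; apply: val_inj.
- by rewrite (_ : Ordinal a4 = 1) //; apply: val_inj.
- by rewrite (_ : Ordinal a4 = 2) //; apply: val_inj.
- by rewrite (_ : Ordinal a4 = 3) //; apply: val_inj.
Qed.

Lemma sum4 (V : nmodType) (F : 'I_4 -> V) :
  \sum_a F a = F 0 + F 1 + F 2 + F 3.
Proof.
rewrite !big_ord_recl big_ord0 addr0 !addrA.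
by congr (F _ + F _ + F _ + F _); apply: val_inj.
Qed.

Section SphereFrame.
Variables (R : realType) (theta : R).
Local Notation A := (S4loc theta).
Local Notation K := (rcentre A).
Local Notation t := (rcT theta).
Local Notation z := (rcZ2 theta).
Local Notation w := (rcW2 theta).
Local Notation s := (rcS theta).

(** Each E_a, and likewise each derivation d_a, is determined by five elements
    of the real centre: d_a Z = Z (reZ a + i imZ a), d_a W = W (reW a + i imW a)
    and d_a T = reT a, while E_a lists the effect of d_a on the five coordinate
    functions X^i ([vE_row]). *)
Definition reZ (a : 'I_4) : K := nth 0 [:: 0; 0; w; t] a.
Definition imZ (a : 'I_4) : K := nth 0 [:: s; 0; 0; 0] a.
Definition reW (a : 'I_4) : K := nth 0 [:: 0; 0; - z; t] a.
Definition imW (a : 'I_4) : K := nth 0 [:: 0; s; 0; 0] a.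
Definition reT (a : 'I_4) : K := nth 0 [:: 0; 0; 0; - s] a.

Lemma vE_row a : vE theta a = row5
  (X1 theta * rcval (reZ a) - X2 theta * rcval (imZ a))
  (X2 theta * rcval (reZ a) + X1 theta * rcval (imZ a))
  (X3 theta * rcval (reW a) - X4 theta * rcval (imW a))
  (X4 theta * rcval (reW a) + X3 theta * rcval (imW a))
  (rcval (reT a)).
Proof.
elim/ord4_ind: a; rewrite /vE (tnth_nth 0) /= -?expr2 ?opprB
  ?(mulr0, subr0, sub0r, addr0, add0r, mulNr, mulrN, oppr0) //.
Qed.

(** The diagonal entries of the metric h before it is rescaled. *)
Definition frame_normsq (a : 'I_4) : K :=
  nth 0 [:: z * s ^+ 2; w * s ^+ 2; z * w * s; s] a.

Lemma sE : s = z + w.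
Proof. by rewrite /rcS -(sphere_relation theta) addrK. Qed.

Lemma h4_coefE a b : h4_coef theta a b = rcval (frame_normsq a) *+ (a == b).
Proof.
rewrite /h4_coef.
have -> : \sum_(i < 5) star (vE theta a 0 i : A) * (vE theta b 0 i : A) =
  rcval (z * (reZ a * reZ b + imZ a * imZ b)
    + w * (reW a * reW b + imW a * imW b) + reT a * reT b).
  rewrite !vE_row !big_ord_recl big_ord0 addr0 !mxE /=.
  rewrite addrA [X in X + _](re_im_form (Zl_normal theta)).
  rewrite [X in _ + X]addrA [X in _ + (X + _)](re_im_form (Wl_normal theta)).
  by rewrite rcval_star addrA.
have w2 : w = s - z by rewrite sE addrAC subrr add0r.
have t2 : t ^+ 2 = 1 - s by rewrite /rcS opprB addrC subrK.
transitivity (rcval (frame_normsq a *+ (a == b))); last first. by case: eqP. 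
apply: (congr1 (@rcval R A)).
elim/ord4_ind: a; elim/ord4_ind: b;
  rewrite /reZ /imZ /reW /imW /reT /frame_normsq /=.
all: ring: w2 t2.
Qed.

Lemma frame_normsq_unit a : frame_normsq a \is a GRing.unit.
Proof.
have [[zU wU] sU] := (rcZ2_unit theta, rcW2_unit theta, rcS_unit theta).
elim/ord4_ind: a; rewrite /frame_normsq /=.
all: by rewrite ?unitrM ?unitrX ?zU ?wU ?sU.
Qed.

(** Pairing with the rows E_a reads off the coordinates up to invertible
    factors; this is what makes the rows free. *)
Lemma h4_coef_span (c : 'I_4 -> A) a :
  \sum_(i < 5) star (vE theta a 0 i : A)
    * (M4val (\sum_b Efr b :*r c b) 0 i : A)
  = rcval (frame_normsq a) * c a.
Proof.
transitivity (\sum_b h4_coef theta a b * c b); last first.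
  rewrite (bigD1 a) //= h4_coefE eqxx big1 ?addr0 // => b /negbTE ab.
  by rewrite h4_coefE eq_sym ab mul0r.
under [RHS]eq_bigr do rewrite mulr_suml.
rewrite exchange_big; apply: eq_bigr => i _ /=.
have -> : M4val (\sum_b Efr b :*r c b) 0 i = \sum_b (vE theta b 0 i : A) * c b.
  rewrite -[M4val _]/(val _) raddf_sum summxE; apply: eq_bigr => b _.
  by rewrite mxE.
by rewrite mulr_sumr; apply: eq_bigr => b _; rewrite mulrA.
Qed.

Lemma sphere_frame : frame (@Efr R theta) (@M4_coord R theta).
Proof.
have sumE U : \sum_a Efr a :*r M4_coord U a = U by rewrite /M4_coord; case: cid.
have unit a : rcval (frame_normsq a) \is a GRing.unit := frame_normsq_unit a.
split=> // c a; apply: (mulrI (unit a)).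
by rewrite -[RHS]h4_coef_span -h4_coef_span sumE.
Qed.

Lemma h4E U V : h4 U V =
  \sum_a star (M4_coord U a) * rcval (frame_normsq a) * (M4_coord V a : A).
Proof.
apply: eq_bigr => a _; rewrite (bigD1 a) //= h4_coefE eqxx big1 ?addr0 //.
by move=> b /negbTE ab; rewrite h4_coefE eq_sym ab mulr0 mul0r.
Qed.

End SphereFrame.

(** * The derivations and their brackets *)

Section SphereDerivations.
Variables (R : realType) (theta : R).
Local Notation A := (S4loc theta).
Local Notation K := (rcentre A).
Local Notation t := (rcT theta).
Local Notation z := (rcZ2 theta).
Local Notation w := (rcW2 theta).
Local Notation s := (rcS theta).

Variables dt1 dt2 dt3 dt4 : A -> A.
Hypothesis dt1_def : [/\ hermitian_derivation dt1,
  dt1 Zl = 'i%C *: Zl, dt1 Wl = 0 & dt1 Tl = 0].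
Hypothesis dt2_def : [/\ hermitian_derivation dt2,
  dt2 Zl = 0, dt2 Wl = 'i%C *: Wl & dt2 Tl = 0].
Hypothesis dt3_def : [/\ hermitian_derivation dt3,
  dt3 Zl = Zl * W2, dt3 Wl = - (Wl * Z2) & dt3 Tl = 0].
Hypothesis dt4_def : [/\ hermitian_derivation dt4,
  dt4 Zl = Zl * Tl, dt4 Wl = Wl * Tl & dt4 Tl = Tl ^+ 2 - 1].

Definition frame_der (a : 'I_4) : A -> A :=
  nth dt4 [:: pd1 dt1 0; pd2 dt2 0; pd3 dt3 0] a.
Local Notation D := frame_der.

Lemma pd1E n u : pd1 dt1 n u = rcval (t ^+ n) * D 0 u.
Proof. by rewrite /frame_der /= /pd1 rmorphXn /= expr0 mul1r mulrA. Qed.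

Lemma pd2E n u : pd2 dt2 n u = rcval (t ^+ n) * D 1 u.
Proof. by rewrite /frame_der /= /pd2 rmorphXn /= expr0 mul1r mulrA. Qed.

Lemma pd3E n u : pd3 dt3 n u = rcval (t ^+ n) * D 2 u.
Proof. by rewrite /frame_der /= /pd3 rmorphXn /= expr0 mul1r. Qed.

Lemma frame_der_herm a : hermitian_derivation (D a).
Proof.
elim/ord4_ind: a; rewrite /frame_der /=.
- by case: dt1_def => dP _ _ _; apply: (der_scale (t ^+ 0 * s) dP).
- by case: dt2_def => dP _ _ _; apply: (der_scale (t ^+ 0 * s) dP).
- by case: dt3_def => dP _ _ _; apply: (der_scale (t ^+ 0) dP).
- by case: dt4_def.
Qed.

Definition rc_complex (x y : K) : A := rcval x + 'i%C *: rcval y.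

Lemma frame_der_Z a : D a Zl = Zl * rc_complex (reZ theta a) (imZ theta a).
Proof.
rewrite /rc_complex; elim/ord4_ind: a;
  rewrite /frame_der /reZ /imZ /= /pd1 /pd2 /pd3 ?expr0 ?mul1r.
- case: dt1_def => _ -> _ _; rewrite -rcS_val rcvalC add0r.
  by rewrite -scalerAl -scalerAr.
- by case: dt2_def => _ -> _ _; rewrite scaler0 addr0 !mulr0.
- by case: dt3_def => _ -> _ _; rewrite scaler0 addr0.
- by case: dt4_def => _ -> _ _; rewrite scaler0 addr0.
Qed.

Lemma frame_der_W a : D a Wl = Wl * rc_complex (reW theta a) (imW theta a).
Proof.
rewrite /rc_complex; elim/ord4_ind: a;
  rewrite /frame_der /reW /imW /= /pd1 /pd2 /pd3 ?expr0 ?mul1r.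
- by case: dt1_def => _ _ -> _; rewrite scaler0 addr0 !mulr0.
- case: dt2_def => _ _ -> _; rewrite -rcS_val rcvalC add0r.
  by rewrite -scalerAl -scalerAr.
- by case: dt3_def => _ _ -> _; rewrite scaler0 addr0 mulrN.
- by case: dt4_def => _ _ -> _; rewrite scaler0 addr0.
Qed.

Lemma frame_der_T a : D a Tl = rcval (reT theta a).
Proof.
elim/ord4_ind: a; rewrite /frame_der /reT /= /pd1 /pd2 /pd3.
- by case: dt1_def => _ _ _ ->; rewrite mulr0.
- by case: dt2_def => _ _ _ ->; rewrite mulr0.
- by case: dt3_def => _ _ _ ->; rewrite mulr0.
- by case: dt4_def => _ _ _ ->; rewrite opprB.
Qed.

Lemma rc_complexC x y u : rc_complex x y * u = u * rc_complex x y.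
Proof. by rewrite mulrDl mulrDr rcvalC -scalerAl -scalerAr (rcvalC y). Qed.

Lemma rc_complex_star x y :
  rc_complex x y + star (rc_complex x y) = rcval (x *+ 2).
Proof.
have -> : rcval (x *+ 2) = rcval x + rcval x by [].
rewrite /rc_complex starD starZ !rcval_star addrACA -scalerDl.
by rewrite (_ : 'i%C + 'i^* = 0) ?scale0r ?addr0 //; simpc.
Qed.

Local Notation Dk a := (rcder (frame_der_herm a)).

Lemma frame_der_t a : Dk a t = reT theta a.
Proof. by apply: val_inj; apply: frame_der_T. Qed.

(** The phase i y cancels between X and its star, so only the real part acts on
    X X^*. *)
Lemma der_norm d (X : A) x y : hermitian_derivation d ->
  d X = X * rc_complex x y -> d (X * star X) = X * star X * rcval (x *+ 2).
Proof.
move=> dP dX; rewrite (derM dP) (der_star dP) dX starM.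
rewrite -[X * rc_complex x y * _]mulrA rc_complexC mulrA.
rewrite [star (rc_complex x y) * _](_ : _ = star X * star (rc_complex x y));
  last first.
  by rewrite -[LHS]starK starM !starK -rc_complexC starM.
by rewrite [X * (_ * _)]mulrA -mulrDr rc_complex_star.
Qed.

Lemma frame_der_z a : Dk a z = 2 * z * reZ theta a.
Proof.
have -> : 2 * z * reZ theta a = z * (reZ theta a *+ 2) by ring.
by apply: val_inj; apply: (der_norm (frame_der_herm a) (frame_der_Z a)).
Qed.

Lemma frame_der_w a : Dk a w = 2 * w * reW theta a.
Proof.
have -> : 2 * w * reW theta a = w * (reW theta a *+ 2) by ring.
by apply: val_inj; apply: (der_norm (frame_der_herm a) (frame_der_W a)).
Qed.

Lemma frame_der_s a : Dk a s = - (2 * t * reT theta a).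
Proof.
rewrite /rcS rcderD rcderN rcder1 expr2 rcderM frame_der_t.
by ring.
Qed.

(** The brackets are [d_4, d_i] = 2 T d_i for i = 1, 2, 3; those of d_1, d_2
    and d_3 with each other vanish. *)
Definition struct_const (a b c : 'I_4) : K :=
  2 * t *+ ((a == 3) && (b == c)) - 2 * t *+ ((b == 3) && (a == c)).
Local Notation f := struct_const.

Lemma struct_constN a b c : f a b c = - f b a c.
Proof. by rewrite /f opprB. Qed.

Lemma sum_struct_const (G : 'I_4 -> K) a b :
  \sum_c f a b c * G c =
  2 * t * (G b *+ (a == 3) - G a *+ (b == 3)).
Proof.
rewrite /f; under eq_bigr do rewrite mulrBl.
have pick (P : bool) e :
    \sum_c 2 * t *+ (P && (e == c)) * G c = 2 * t * (G e *+ P).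
  rewrite (bigD1 e) //= eqxx andbT big1 ?addr0 => [|c /negbTE ce].
    by rewrite mulrnAl mulrnAr.
  by rewrite eq_sym ce andbF mul0r.
by rewrite sumrB !pick mulrBr.
Qed.

Let Dk0 a : Dk a 0 = 0. Proof. exact: rcder0. Qed.

Ltac bracket_tac a b :=
  rewrite sum_struct_const; elim/ord4_ind: a; elim/ord4_ind: b;
  rewrite /reZ /reW /imZ /imW /reT /= ?rcderN ?Dk0
    ?frame_der_z ?frame_der_w ?frame_der_t ?frame_der_s /reZ /reW /reT /=; ring.

Lemma bracket_reZ a b :
  Dk a (reZ theta b) - Dk b (reZ theta a) = \sum_c f a b c * reZ theta c.
Proof. bracket_tac a b. Qed.

Lemma bracket_imZ a b :
  Dk a (imZ theta b) - Dk b (imZ theta a) = \sum_c f a b c * imZ theta c.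
Proof. bracket_tac a b. Qed.

Lemma bracket_reW a b :
  Dk a (reW theta b) - Dk b (reW theta a) = \sum_c f a b c * reW theta c.
Proof. by bracket_tac a b. Qed.

Lemma bracket_imW a b :
  Dk a (imW theta b) - Dk b (imW theta a) = \sum_c f a b c * imW theta c.
Proof. by bracket_tac a b. Qed.

Lemma bracket_reT a b :
  Dk a (reT theta b) - Dk b (reT theta a) = \sum_c f a b c * reT theta c.
Proof. by bracket_tac a b. Qed.

(** The terms X zeta_a zeta_b cancel in the bracket, which leaves X times the
    difference of the derivatives of zeta_b and zeta_a; here d_c multiplies X
    by zeta_c = x_c + i y_c. *)
Lemma bracket_rc_complex (X : A) (x y : 'I_4 -> K) a b :
  (forall c, D c X = X * rc_complex (x c) (y c)) ->
  Dk a (x b) - Dk b (x a) = \sum_c f a b c * x c ->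
  Dk a (y b) - Dk b (y a) = \sum_c f a b c * y c ->
  lie_bracket (D a) (D b) X = der_comb D (f a b) X.
Proof.
move=> DX ex ey.
have Dphase c e : D c (rc_complex (x e) (y e)) =
    rc_complex (Dk c (x e)) (Dk c (y e)).
  by rewrite (derD (frame_der_herm c)) (derZ (frame_der_herm c)).
rewrite /lie_bracket !DX !(derM (frame_der_herm _)) !DX !Dphase.
rewrite -!mulrA [rc_complex (x a) _ * _]rc_complexC opprD addrACA subrr add0r.
rewrite -mulrBr.
transitivity (X * rc_complex (\sum_c f a b c * x c) (\sum_c f a b c * y c)).
  rewrite -ex -ey; congr (_ * _).
  by rewrite /rc_complex opprD addrACA -scalerBr.
rewrite /rc_complex !rmorph_sum scaler_sumr -big_split mulr_sumr.
apply: eq_bigr => c _; rewrite DX mulrA (rcvalC (f a b c) X) -mulrA.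
by rewrite /rc_complex !mulrDr -!scalerAr.
Qed.

(** Both sides are hermitian derivations, so they only have to be compared on
    Z, W and T. *)
Lemma frame_der_bracket a b u :
  lie_bracket (D a) (D b) u = \sum_c rcval (f a b c) * D c u.
Proof.
have DP := frame_der_herm.
have lP := der_lie (DP a) (DP b); have cP := der_comb_herm (f a b) DP.
apply: (der_ext lP cP) u.
- apply: (bracket_rc_complex frame_der_Z (bracket_reZ _ _)).
  exact: bracket_imZ.
- apply: (bracket_rc_complex frame_der_W (bracket_reW _ _)).
  exact: bracket_imW.
- have := congr1 (@rcval R A) (bracket_reT a b).
  rewrite /lie_bracket /der_comb !frame_der_T rmorph_sum => {}e.
  rewrite [LHS]e.
  by apply: eq_bigr => c _; rewrite frame_der_T.
Qed.

(** Half the logarithmic derivative of 1 - T^2, nonzero only along d_4;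
    together with those of |Z|^2 and |W|^2, which are reZ and reW, it yields the
    half logarithmic derivatives of the square norms. *)
Definition log_der_s (a : 'I_4) : K := t *+ (a == 3).

Definition log_der_normsq (a b : 'I_4) : K := let sigma := log_der_s a in
  nth 0 [:: reZ theta a + 2 * sigma; reW theta a + 2 * sigma;
            reZ theta a + reW theta a + sigma; sigma] b.

Lemma frame_der_normsq a b :
  Dk a (frame_normsq theta b) = 2 * log_der_normsq a b * frame_normsq theta b.
Proof.
have es : Dk a s = 2 * log_der_s a * s.
  by rewrite frame_der_s /log_der_s; elim/ord4_ind: a; rewrite /reT /=; ring.
rewrite /log_der_normsq; elim/ord4_ind: b;
  rewrite /frame_normsq /= ?expr2 ?rcderM ?frame_der_z ?frame_der_w es; ring.
Qed.

End SphereDerivations.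

(** * The Lie algebra and its anchor *)

Section RealPolynomials.
Variables (R : realType) (A : unitStarAlgType R) (t : rcentre A).
Local Notation K := (rcentre A).

Fact real_scalar_central (r : R) : (r%:C)%:A \in (real_central : {pred A}).
Proof.
apply/real_centralP; split=> [|b]; last by rewrite mulr_algr mulr_algl.
by rewrite starZ star1 conjc_real.
Qed.

Definition real_scalar (r : R) : K := RCentre (real_scalar_central r).

Fact real_scalar_zmod : zmod_morphism real_scalar.
Proof. by move=> a b; apply: val_inj; rewrite /= rmorphB scalerBl. Qed.

Fact real_scalar_monoid : monoid_morphism real_scalar.
Proof.
split=> [|a b]; apply: val_inj; first by rewrite /= scale1r.
by rewrite /= rmorphM mulr_algl scalerA.
Qed.

HB.instance Definition _ :=
  GRing.isZmodMorphism.Build R K real_scalar real_scalar_zmod.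
HB.instance Definition _ :=
  GRing.isMonoidMorphism.Build R K real_scalar real_scalar_monoid.

Definition ev (p : {poly R}) : K := (map_poly real_scalar p).[t].

Fact ev_zmod : zmod_morphism ev.
Proof. by move=> p q; rewrite /ev rmorphB hornerD hornerN. Qed.

Fact ev_monoid : monoid_morphism ev.
Proof. by split=> [|p q]; rewrite /ev ?rmorph1 ?hornerC // rmorphM hornerM. Qed.

HB.instance Definition _ :=
  GRing.isZmodMorphism.Build {poly R} K ev ev_zmod.
HB.instance Definition _ :=
  GRing.isMonoidMorphism.Build {poly R} K ev ev_monoid.

Lemma evX : ev 'X = t.
Proof. by rewrite /ev map_polyX hornerX. Qed.

Lemma evC c : ev c%:P = real_scalar c.
Proof. by rewrite /ev map_polyC hornerC. Qed.

Lemma evZ c p : ev (c *: p) = real_scalar c * ev p.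
Proof. by rewrite -mul_polyC rmorphM /= evC. Qed.

(** Derivations kill the real scalars, hence the chain rule for polynomials. *)
Lemma rcder_ev d (dP : hermitian_derivation d) p :
  rcder dP (ev p) = ev p^`() * rcder dP t.
Proof.
have dC c : rcder dP (real_scalar c) = 0.
  by apply: val_inj; rewrite /= (derZ dP) (der1 dP) scaler0.
elim/poly_ind: p => [|p c IHp].
  by rewrite deriv0 !rmorph0 rcder0 mul0r.
rewrite rmorphD rmorphM /= evX evC rcderD rcderM dC IHp addr0.
rewrite derivD derivM derivX derivC addr0 mulr1 rmorphD rmorphM /= evX.
by ring.
Qed.

End RealPolynomials.

Section RealSpan.
Variables (R : realType) (A : starAlgType R) (G : set (A -> A)).

Lemma real_span_zero : real_span G (fun=> 0).
Proof.
exists 0, (fun=> 0), (fun=> id); split=> [[]//|].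
by apply/funext => a; rewrite big_ord0.
Qed.

Lemma real_span_gen d : G d -> real_span G d.
Proof.
move=> Gd; exists 1, (fun=> 1), (fun=> d); split=> //.
by apply/funext => a; rewrite big_ord1 scale1r.
Qed.

Lemma real_span_scale (r : R) d : real_span G d -> real_span G (r%:C \*: d).
Proof.
move=> [n [q [F [GF ->]]]]; exists n, (fun k => r * q k), F; split=> //.
apply/funext => a /=; rewrite scaler_sumr; apply: eq_bigr => k _.
by rewrite scalerA rmorphM.
Qed.

Lemma real_span_add d e :
  real_span G d -> real_span G e -> real_span G (d \+ e).
Proof.
move=> [n [q [F [GF ->]]]] [m [q' [F' [GF' ->]]]].
exists (n + m)%N.
exists (fun k => match fintype.split k with inl i => q i | inr j => q' j end).
exists (fun k => match fintype.split k with inl i => F i | inr j => F' j end).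
split=> [k|]; first by case: (fintype.split k).
apply/funext => a; rewrite big_split_ord /=.
congr (_ + _); apply: eq_bigr => k _.
  by rewrite (unsplitK (inl k)).
by rewrite (unsplitK (inr k)).
Qed.

End RealSpan.

Section SphereLieAlgebra.
Variables (R : realType) (theta : R).
Local Notation A := (S4loc theta).
Local Notation K := (rcentre A).
Local Notation t := (rcT theta).
Local Notation s := (rcS theta).

Variables dt1 dt2 dt3 dt4 : A -> A.
Hypothesis dt1_def : [/\ hermitian_derivation dt1,
  dt1 Zl = 'i%C *: Zl, dt1 Wl = 0 & dt1 Tl = 0].
Hypothesis dt2_def : [/\ hermitian_derivation dt2,
  dt2 Zl = 0, dt2 Wl = 'i%C *: Wl & dt2 Tl = 0].
Hypothesis dt3_def : [/\ hermitian_derivation dt3,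
  dt3 Zl = Zl * W2, dt3 Wl = - (Wl * Z2) & dt3 Tl = 0].
Hypothesis dt4_def : [/\ hermitian_derivation dt4,
  dt4 Zl = Zl * Tl, dt4 Wl = Wl * Tl & dt4 Tl = Tl ^+ 2 - 1].

Local Notation D := (frame_der dt1 dt2 dt3 dt4).
Local Notation g := (g4 dt1 dt2 dt3 dt4).
Let DP := frame_der_herm dt1_def dt2_def dt3_def dt4_def.

(** Elements of g correspond to p whose last coefficient is a constant, see
    [g4_poly_field] and [phi_poly_field]. *)
Definition poly_field (p : 'I_4 -> {poly R}) : A -> A :=
  der_comb D (fun a => ev t (p a)).
Local Notation vf := poly_field.

Definition monomial_coef (a : 'I_4) (n : nat) : 'I_4 -> {poly R} :=
  fun b => 'X^n *+ (b == a).

Lemma poly_field_add p q : vf (fun a => p a + q a) = vf p \+ vf q.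
Proof.
apply/funext => u; rewrite /poly_field /der_comb /= -big_split.
by apply: eq_bigr => a _; rewrite rmorphD /= mulrDl.
Qed.

Lemma poly_field_scale (r : R) p : vf (fun a => r *: p a) = r%:C \*: vf p.
Proof.
apply/funext => u; rewrite /poly_field /der_comb /= scaler_sumr.
by apply: eq_bigr => a _; rewrite evZ /= mulr_algl scalerAl.
Qed.

Lemma poly_field_sum N (F : 'I_N -> 'I_4 -> {poly R}) u :
  vf (fun a => \sum_k F k a) u = \sum_k vf (F k) u.
Proof.
rewrite /poly_field /der_comb exchange_big; apply: eq_bigr => a _.
by rewrite !rmorph_sum mulr_suml.
Qed.

Lemma poly_field_monomial a n u :
  vf (monomial_coef a n) u = rcval (t ^+ n) * D a u.
Proof.
rewrite /poly_field /der_comb (bigD1 a) //= big1 ?addr0 => [|b /negbTE ba].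
  by rewrite /monomial_coef eqxx rmorphXn /= evX.
by rewrite /monomial_coef ba rmorph0 mul0r.
Qed.

Lemma g4_poly_field d : g d ->
  exists2 p : 'I_4 -> {poly R}, (size (p 3%R) <= 1)%N & d = vf p.
Proof.
move=> [N [r [F [GF ->]]]].
have /choice[p Fp] : forall k, exists p : 'I_4 -> {poly R},
    (size (p 3%R) <= 1)%N /\ F k = vf p.
  move=> k; have mono3 a n : a != 3 -> (size (monomial_coef a n 3%R) <= 1)%N.
    by rewrite /monomial_coef eq_sym => /negbTE ->; rewrite size_poly0.
  case: (GF k) => [[n ->]|[[n ->]|[[n ->]|->]]].
  - exists (monomial_coef 0 n); split; first exact: mono3.
    by apply/funext => u; rewrite poly_field_monomial (pd1E dt1 dt2 dt3 dt4).
  - exists (monomial_coef 1 n); split; first exact: mono3.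
    by apply/funext => u; rewrite poly_field_monomial (pd2E dt1 dt2 dt3 dt4).
  - exists (monomial_coef 2 n); split; first exact: mono3.
    by apply/funext => u; rewrite poly_field_monomial (pd3E dt1 dt2 dt3 dt4).
  - exists (monomial_coef 3 0); split.
      by rewrite /monomial_coef eqxx expr0 size_poly1.
    by apply/funext => u; rewrite poly_field_monomial expr0 mul1r.
exists (fun a => \sum_k r k *: p k a).
  apply: (big_ind (fun q : {poly R} => (size q <= 1)%N)).
  - by rewrite size_poly0.
  - by move=> x y sx sy; rewrite (leq_trans (size_polyD _ _)) // geq_max sx.
  - by move=> k _; rewrite (leq_trans (size_scale_leq _ _)) //; case: (Fp k).
apply/funext => u; rewrite poly_field_sum; apply: eq_bigr => k _.
by rewrite poly_field_scale; have [_ ->] := Fp k.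
Qed.

Lemma sum_sum_struct_const (x y : 'I_4 -> K) c :
  \sum_a \sum_b x a * y b * struct_const theta a b c =
  2 * t * (x 3 * y c - x c * y 3).
Proof.
have pick (u v : 'I_4 -> K) :
    \sum_a \sum_b u a * v b * (2 * t *+ ((a == 3) && (b == c))) =
    2 * t * (u 3 * v c).
  rewrite (bigD1 3) //= [X in _ + X]big1 ?addr0 => [|a /negbTE a3]; last first.
    by apply: big1 => b _; rewrite a3 mulr0.
  rewrite (bigD1 c) //= !eqxx big1 ?addr0 => [|b /negbTE bc].
    by rewrite mulr1n mulrC.
  by rewrite bc mulr0.
rewrite mulrBr -pick [x c * _]mulrC -pick [X in _ = _ - X]exchange_big -sumrB.
apply: eq_bigr => a _; rewrite -sumrB; apply: eq_bigr => b _.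
by rewrite mulrBr [y b * _]mulrC.
Qed.

(** The action of d_4 on polynomials in T, since d_4 T = T^2 - 1. *)
Definition T_der (p : {poly R}) : {poly R} := p^`() * ('X^2 - 1).

Lemma poly_field_ev p q : vf p (rcval (ev t q)) = rcval (ev t (p 3 * T_der q)).
Proof.
have -> : vf p (rcval (ev t q)) =
    rcval (\sum_a ev t (p a) * rcder (DP a) (ev t q)).
  by rewrite rmorph_sum.
congr rcval; rewrite sum4 !rcder_ev !frame_der_t /reT /=.
rewrite /T_der !rmorphM rmorphB rmorphXn rmorph1 /= evX /rcS.
by ring.
Qed.

(** The coefficients of the bracket of two polynomial fields.  Among
    the d_a only d_4 differentiates polynomials in T, and the last summand comes
    from the brackets [d_4, d_i] = 2 T d_i. *)
Definition bracket_coef (p q : 'I_4 -> {poly R}) (c : 'I_4) : {poly R} :=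
  p 3 * T_der (q c) - q 3 * T_der (p c) + 2 * 'X * (p 3 * q c - p c * q 3).

Lemma bracket_coefE p q c : rcval (ev t (bracket_coef p q c)) =
  vf p (rcval (ev t (q c))) - vf q (rcval (ev t (p c)))
  + \sum_a \sum_b rcval (ev t (p a)) * rcval (ev t (q b))
      * rcval (struct_const theta a b c).
Proof.
rewrite !poly_field_ev.
transitivity (rcval (ev t (p 3 * T_der (q c)) - ev t (q 3 * T_der (p c))
  + \sum_a \sum_b ev t (p a) * ev t (q b) * struct_const theta a b c)).
  congr rcval; rewrite sum_sum_struct_const rmorphD rmorphB; congr (_ + _).
  by rewrite rmorphM rmorphM rmorph_nat rmorphB !rmorphM /= evX.
rewrite /=; congr (_ + _); rewrite rmorph_sum; apply: eq_bigr => a _.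
by rewrite rmorph_sum.
Qed.

Lemma lie_poly_field p q :
  lie_bracket (vf p) (vf q) = vf (bracket_coef p q).
Proof.
have bracket := frame_der_bracket dt1_def dt2_def dt3_def dt4_def.
apply/funext => u; rewrite (lie_der_comb _ _ _ DP bracket).
by apply: eq_bigr => c _; rewrite bracket_coefE.
Qed.

(** When p_4 and q_4 are constants the last coefficient of the bracket is zero:
    this is the closure of g under the bracket. *)
Lemma bracket_coef_size (p q : 'I_4 -> {poly R}) :
  (size (p 3%R) <= 1)%N -> (size (q 3%R) <= 1)%N ->
  (size (bracket_coef p q 3%R) <= 1)%N.
Proof.
move=> /size1_polyC p3 /size1_polyC q3.
rewrite (_ : bracket_coef p q 3 = 0) ?size_poly0 //.
rewrite /bracket_coef /T_der p3 q3 !derivC.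
by ring.
Qed.

Section Anchor.
Variable phi : (A -> A) -> M4 theta.
Hypothesis phi_linear : real_linear_on g phi.
Hypothesis phi1 : forall n, phi (pd1 dt1 n) = E1 :*r Tl ^+ n.
Hypothesis phi2 : forall n, phi (pd2 dt2 n) = E2 :*r Tl ^+ n.
Hypothesis phi3 : forall n, phi (pd3 dt3 n) = E3 :*r Tl ^+ n.
Hypothesis phi4 : phi dt4 = E4.

Let good p := g (vf p) /\ phi (vf p) = \sum_a Efr a :*r rcval (ev t (p a)).

Let good_add p q : good p -> good q -> good (fun a => p a + q a).
Proof.
move=> [gp phip] [gq phiq]; rewrite /good poly_field_add; split.
  exact: real_span_add.
rewrite phi_linear.1 // phip phiq -big_split; apply: eq_bigr => a _.
by rewrite rmorphD /= ractDr.
Qed.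

Let good_scale (r : R) p : good p -> good (fun a => r *: p a).
Proof.
move=> [gp phip]; rewrite /good poly_field_scale; split.
  exact: real_span_scale.
rewrite phi_linear.2 // phip ract_suml; apply: eq_bigr => a _.
by rewrite ractA evZ /= mulr_algl mulr_algr.
Qed.

(** The monomial fields are the spanning derivations of g, except that along d_4
    only the power T^0 occurs. *)
Let good_monomial a n : (a == 3 -> n = 0%N) -> good (monomial_coef a n).
Proof.
have phi_mono :
    \sum_b Efr b :*r rcval (ev t (monomial_coef a n b)) = Efr a :*r Tl ^+ n.
  rewrite (bigD1 a) //= big1 ?addr0 => [|b /negbTE ba].
    by rewrite /monomial_coef eqxx rmorphXn /= evX rmorphXn.
  by rewrite /monomial_coef ba rmorph0 ract0.
rewrite /good phi_mono.
have -> : vf (monomial_coef a n) = fun u => rcval (t ^+ n) * D a u.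
  by apply/funext => u; rewrite poly_field_monomial.
elim/ord4_ind: a {phi_mono} => a3.
- have <- : pd1 dt1 n = (fun u => rcval (t ^+ n) * D 0 u).
    by apply/funext => u; rewrite -(pd1E dt1 dt2 dt3 dt4).
  by split=> //; apply: real_span_gen; left; exists n.
- have <- : pd2 dt2 n = (fun u => rcval (t ^+ n) * D 1 u).
    by apply/funext => u; rewrite -(pd2E dt1 dt2 dt3 dt4).
  by split=> //; apply: real_span_gen; right; left; exists n.
- have <- : pd3 dt3 n = (fun u => rcval (t ^+ n) * D 2 u).
    by apply/funext => u; rewrite -(pd3E dt1 dt2 dt3 dt4).
  by split=> //; apply: real_span_gen; right; right; left; exists n.
- rewrite a3 // (_ : (fun u => _) = dt4); last first.
    by apply/funext => u; rewrite expr0 mul1r.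
  rewrite expr0 ract1; split=> //; apply: real_span_gen.
  by right; right; right.
Qed.

Let good_sum N (F : 'I_N -> 'I_4 -> {poly R}) :
  (forall k, good (F k)) -> good (fun a => \sum_k F k a).
Proof.
elim: N F => [|N IHN] F GF.
  rewrite (_ : (fun a => _) = (fun a => 0 *: monomial_coef 3 0 a)).
  by apply: good_scale; apply: good_monomial.
  by apply/funext => a; rewrite big_ord0 scale0r.
rewrite (_ : (fun a => _) =
  (fun a => \sum_k F (widen_ord (leqnSn N) k) a + F ord_max a)).
  by apply: good_add => //; apply: IHN.
by apply/funext => a; rewrite big_ord_recr.
Qed.

(** Polynomial fields are real combinations of monomial ones, on which phi is
    prescribed, and phi is real linear on g. *)
Lemma phi_poly_field (p : 'I_4 -> {poly R}) : (size (p 3%R) <= 1)%N ->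
  g (vf p) /\ phi (vf p) = \sum_a Efr a :*r rcval (ev t (p a)).
Proof.
move=> p3; rewrite -/(good p).
have -> : p = fun b =>
    \sum_a \sum_(i < size (p a)) (p a)`_i *: monomial_coef a i b.
  apply/funext => b; rewrite (bigD1 b) //=.
  rewrite [X in _ + X]big1 ?addr0 => [|a /negbTE ab].
    rewrite -[LHS]coefK poly_def; apply: eq_bigr => i _.
    by rewrite /monomial_coef eqxx.
  by apply: big1 => i _; rewrite /monomial_coef eq_sym ab scaler0.
apply: good_sum => a; apply: good_sum => i; apply/good_scale/good_monomial.
move=> /eqP a3; move: i; rewrite a3 => i.
by apply/eqP; rewrite -leqn0 -ltnS (leq_trans (ltn_ord i)).
Qed.

Lemma sphere_lie_algebra : real_lie_algebra g.
Proof.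
split.
- by move=> d /g4_poly_field[p _ ->]; apply: der_comb_herm.
- exact: real_span_zero.
- by move=> d e; apply: real_span_add.
- by move=> r d; apply: real_span_scale.
- move=> d e /g4_poly_field[p p3 ->] /g4_poly_field[q q3 ->].
  rewrite lie_poly_field; apply: (phi_poly_field _).1.
  exact: bracket_coef_size.
Qed.

Lemma coord_phi_poly_field (p : 'I_4 -> {poly R}) a : (size (p 3%R) <= 1)%N ->
  M4_coord (phi (vf p)) a = rcval (ev t (p a)).
Proof.
move=> /phi_poly_field[_ ->].
by rewrite (frame_coord (sphere_frame theta) (fun b => rcval (ev t (p b)))).
Qed.

Lemma sphere_anchor d : g d -> exists k : 'I_4 -> K,
  (forall a, M4_coord (phi d) a = rcval (k a)) /\
  (forall u, d u = \sum_a rcval (k a) * D a u).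
Proof.
move=> /g4_poly_field[p p3 ->]; exists (fun a => ev t (p a)); split=> // a.
exact: coord_phi_poly_field.
Qed.

Lemma sphere_phi_bracket d1 d2 c : g d1 -> g d2 ->
  M4_coord (phi (lie_bracket d1 d2)) c =
    d1 (M4_coord (phi d2) c) - d2 (M4_coord (phi d1) c)
    + \sum_a \sum_b M4_coord (phi d1) a * M4_coord (phi d2) b
        * rcval (struct_const theta a b c).
Proof.
move=> /g4_poly_field[p p3 ->] /g4_poly_field[q q3 ->].
rewrite lie_poly_field !coord_phi_poly_field ?bracket_coef_size //.
rewrite bracket_coefE; congr (_ + _).
by apply: eq_bigr => a _; apply: eq_bigr => b _; rewrite !coord_phi_poly_field.
Qed.

Lemma phi_frame_der a : g (D a) /\ phi (D a) = Efr a.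
Proof.
have e : D a = vf (monomial_coef a 0).
  by apply/funext => u; rewrite poly_field_monomial expr0 mul1r.
have [|ga ea] := @good_monomial a 0; first by [].
rewrite e; split=> //; rewrite ea (bigD1 a) //= big1 ?addr0 => [|b /negbTE ba].
  by rewrite /monomial_coef eqxx expr0 rmorph1 ract1.
by rewrite /monomial_coef ba rmorph0 ract0.
Qed.

End Anchor.

End SphereLieAlgebra.

(** * The connection on the four-sphere *)

Section SphereConnection.
Variables (R : realType) (theta : R).
Local Notation A := (S4loc theta).
Local Notation K := (rcentre A).
Local Notation t := (rcT theta).
Local Notation z := (rcZ2 theta).
Local Notation w := (rcW2 theta).
Local Notation s := (rcS theta).
Local Notation eta := (frame_normsq theta).

Variable alpha : 'I_4 -> K.

Local Notation Gamma := (christoffel eta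
  (conformal_der eta (@log_der_normsq R theta) alpha) (@struct_const R theta)).

(** Entry (a, b, c) is the coefficient of E_c in nabla_a E_b for the metric
    delta h. *)
Definition sphere_christoffel (a b c : 'I_4) : K :=
  let: (a1, a2, a3, a4) := (alpha 0, alpha 1, alpha 2, alpha 3) in
  nth 0 (nth [::] (nth [::]
    [:: [:: [:: a1; - (a2 * z * w^-1);
                - ((a3 * w^-1 + 1) * s); - ((a4 + t) * z * s)];
            [:: a2; a1; 0; 0];
            [:: a3 + w; 0; a1; 0];
            [:: a4 + t; 0; 0; a1]];
        [:: [:: a2; a1; 0; 0];
            [:: - (a1 * w * z^-1); a2;
                - ((a3 * z^-1 - 1) * s); - ((a4 + t) * w * s)];
            [:: 0; a3 - z; a2; 0];
            [:: 0; a4 + t; 0; a2]];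
        [:: [:: a3 + w; 0; a1; 0];
            [:: 0; a3 - z; a2; 0];
            [:: - (a1 * w * s^-1); - (a2 * z * s^-1);
                a3 + w - z; - ((a4 + t) * z * w)];
            [:: 0; 0; a4 + t; a3]];
        [:: [:: a4 + 3 * t; 0; 0; a1];
            [:: 0; a4 + 3 * t; 0; a2];
            [:: 0; 0; a4 + 3 * t; a3];
            [:: - (a1 * z^-1 * s^-1); - (a2 * w^-1 * s^-1);
                - (a3 * z^-1 * w^-1); a4 + t]]] a) b) c.

Lemma christoffelE a b c : Gamma a b c = sphere_christoffel a b c.
Proof.
apply: christoffel_eq; [exact: rcentre_two_unit|exact: frame_normsq_unit|].
have := (divrr (rcZ2_unit theta)); have := (divrr (rcW2_unit theta)).
have := (divrr (rcS_unit theta)) => ss ww zz.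
elim/ord4_ind: a; elim/ord4_ind: b; elim/ord4_ind: c;
  rewrite /koszul /conformal_der /log_der_normsq /log_der_s /struct_const
    /reZ /reW /frame_normsq /sphere_christoffel /=.
all: ring: zz ww ss.
Qed.

End SphereConnection.

Unset Implicit Arguments.
Set Strict Implicit.
Set Printing Implicit Defensive.

Theorem proposition3p10 (R : realType) (theta : R)
  (theta_range : 0 <= theta < 1)
  (dt1 dt2 dt3 dt4 : S4loc theta -> S4loc theta)
  (dt1_def : [/\ hermitian_derivation dt1,
    dt1 Zl = 'i%C *: Zl, dt1 Wl = 0 & dt1 Tl = 0])
  (dt2_def : [/\ hermitian_derivation dt2,
    dt2 Zl = 0, dt2 Wl = 'i%C *: Wl & dt2 Tl = 0])
  (dt3_def : [/\ hermitian_derivation dt3,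
    dt3 Zl = Zl * W2, dt3 Wl = - (Wl * Z2) & dt3 Tl = 0])
  (dt4_def : [/\ hermitian_derivation dt4,
    dt4 Zl = Zl * Tl, dt4 Wl = Wl * Tl & dt4 Tl = Tl ^+ 2 - 1])
  (phi : (S4loc theta -> S4loc theta) -> M4 theta)
  (phi_linear : real_linear_on (g4 dt1 dt2 dt3 dt4) phi)
  (phi1 : forall n, phi (pd1 dt1 n) = E1 :*r Tl ^+ n)
  (phi2 : forall n, phi (pd2 dt2 n) = E2 :*r Tl ^+ n)
  (phi3 : forall n, phi (pd3 dt3 n) = E3 :*r Tl ^+ n)
  (phi4 : phi dt4 = E4)
  (delta alpha1 alpha2 alpha3 alpha4 : S4loc theta)
  (delta_herm : star delta = delta)
  (delta_regular : GRing.lreg delta /\ GRing.rreg delta)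
  (delta_central : forall a, delta * a = a * delta)
  (alpha1_herm : star alpha1 = alpha1)
  (alpha2_herm : star alpha2 = alpha2)
  (alpha3_herm : star alpha3 = alpha3)
  (alpha4_herm : star alpha4 = alpha4)
  (delta1 : pd1 dt1 0 delta = 2 * alpha1 * delta)
  (delta2 : pd2 dt2 0 delta = 2 * alpha2 * delta)
  (delta3 : pd3 dt3 0 delta = 2 * alpha3 * delta)
  (delta4 : dt4 delta = 2 * alpha4 * delta) :
  let g := g4 dt1 dt2 dt3 dt4 in
  let h := h4_scaled delta in
  let d1 := pd1 dt1 0 in
  let d2 := pd2 dt2 0 in
  let d3 := pd3 dt3 0 in
  let d4 := dt4 in
  exists nabla : (S4loc theta -> S4loc theta) -> M4 theta -> M4 theta,
  [/\ pseudo_riemannian_calculus h g phi nabla,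
      (forall nabla', pseudo_riemannian_calculus h g phi nabla' ->
        forall d U, g d -> nabla' d U = nabla d U),
      [/\ nabla d1 E1 = E1 :*r alpha1 - E2 :*r (alpha2 * Z2 * W2^-1)
            - E3 :*r ((alpha3 * W2^-1 + 1) * (1 - Tl ^+ 2))
            - E4 :*r ((alpha4 + Tl) * Z2 * (1 - Tl ^+ 2)),
          nabla d1 E2 = E1 :*r alpha2 + E2 :*r alpha1 /\
          nabla d2 E1 = E1 :*r alpha2 + E2 :*r alpha1,
          nabla d1 E3 = E1 :*r (alpha3 + W2) + E3 :*r alpha1 /\
          nabla d3 E1 = E1 :*r (alpha3 + W2) + E3 :*r alpha1,
          nabla d1 E4 = E1 :*r (alpha4 + Tl) + E4 :*r alpha1 &
          nabla d4 E1 = E1 :*r (alpha4 + 3 * Tl) + E4 :*r alpha1],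
      [/\ nabla d2 E2 = - (E1 :*r (alpha1 * W2 * Z2^-1)) + E2 :*r alpha2
            - E3 :*r ((alpha3 * Z2^-1 - 1) * (1 - Tl ^+ 2))
            - E4 :*r ((alpha4 + Tl) * W2 * (1 - Tl ^+ 2)),
          nabla d2 E3 = E2 :*r (alpha3 - Z2) + E3 :*r alpha2 /\
          nabla d3 E2 = E2 :*r (alpha3 - Z2) + E3 :*r alpha2,
          nabla d2 E4 = E2 :*r (alpha4 + Tl) + E4 :*r alpha2 &
          nabla d4 E2 = E2 :*r (alpha4 + 3 * Tl) + E4 :*r alpha2] &
      [/\ nabla d3 E3 = - (E1 :*r (alpha1 * W2 * (1 - Tl ^+ 2)^-1))
            - E2 :*r (alpha2 * Z2 * (1 - Tl ^+ 2)^-1)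
            + E3 :*r (alpha3 + W2 - Z2)
            - E4 :*r ((alpha4 + Tl) * Z2 * W2),
          nabla d3 E4 = E3 :*r (alpha4 + Tl) + E4 :*r alpha3,
          nabla d4 E3 = E3 :*r (alpha4 + 3 * Tl) + E4 :*r alpha3,
          nabla d4 E4 = - (E1 :*r (alpha1 * Z2^-1 * (1 - Tl ^+ 2)^-1))
            - E2 :*r (alpha2 * W2^-1 * (1 - Tl ^+ 2)^-1)
            - E3 :*r (alpha3 * Z2^-1 * W2^-1)
            + E4 :*r (alpha4 + Tl) &
          forall (n : nat) (a : 'I_4),
            [/\ nabla (pd1 dt1 n) (Efr a) = nabla d1 (Efr a) :*r Tl ^+ n,
                nabla (pd2 dt2 n) (Efr a) = nabla d2 (Efr a) :*r Tl ^+ n &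
                nabla (pd3 dt3 n) (Efr a) = nabla d3 (Efr a) :*r Tl ^+ n]]].
Proof.
move=> g h d1 d2 d3 d4.
pose D := frame_der dt1 dt2 dt3 dt4.
pose DP := frame_der_herm dt1_def dt2_def dt3_def dt4_def.
pose deltaK : rcentre (S4loc theta) := RCentre
  (introT (real_centralP delta) (conj delta_herm delta_central)).
pose al (a : 'I_4) := nth alpha4 [:: alpha1; alpha2; alpha3] a.
have Ddelta a : D a delta = 2 * al a * delta.
  elim/ord4_ind: a.
  - exact: delta1.
  - exact: delta2.
  - exact: delta3.
  - exact: delta4.
have al_real a : al a \in real_central.
  apply: (@log_der_central R (S4loc theta) (D a) deltaK) => //.
  - exact: delta_regular.2.
  - by elim/ord4_ind: a.
pose alpha (a : 'I_4) : rcentre (S4loc theta) := RCentre (al_real a).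
pose eta a := deltaK * frame_normsq theta a.
pose f := @struct_const R theta.
pose Gamma := christoffel (frame_normsq theta)
  (conformal_der (frame_normsq theta) (@log_der_normsq R theta) alpha) f.
pose nabla := frame_connection Efr (@M4_coord R theta) phi Gamma.
have Ddelta' a : rcder (DP a) deltaK = 2 * alpha a * deltaK.
  by apply: val_inj; apply: Ddelta.
have xP := sphere_frame theta.
have phiD := phi_frame_der phi1 phi2 phi3 phi4.
have lieP : real_lie_algebra g.
  exact: (sphere_lie_algebra dt1_def dt2_def dt3_def dt4_def
    phi_linear phi1 phi2 phi3 phi4).
have etaE a : rcval (eta a) = delta * rcval (frame_normsq theta a) by [].
have calculus : pseudo_riemannian_calculus h g phi nabla.
  apply: (frame_connection_calculus (D := D) (eta := eta) xP).
  - move=> U V; rewrite /h /h4_scaled h4E mulr_sumr; apply: eq_bigr => a _.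
    rewrite etaE.
    by rewrite !mulrA delta_central.
  - move=> a; rewrite etaE.
    by apply: lregM; [exact: delta_regular.1 | apply/mulrI/frame_normsq_unit].
  - exact: lieP.
  - exact: phi_linear.
  - by move=> a; apply: (phiD a).1.
  - by move=> a; apply: (phiD a).2.
  - by apply: sphere_anchor.
  - move=> e1 e2 c g1 g2.
    rewrite (sphere_phi_bracket dt1_def dt2_def dt3_def dt4_def
      phi_linear phi1 phi2 phi3 phi4) //.
    congr (_ + _); apply: eq_bigr => a _; apply: eq_bigr => b _.
    rewrite conformal_torsion //.
    + exact: frame_normsq_unit.
    + exact: struct_constN.
  - exact: (conformal_metric (frame_normsq_unit theta) (@struct_constN R theta)
      (frame_der_normsq dt1_def dt2_def dt3_def dt4_def) Ddelta').
have nablaE a b : nabla (D a) (Efr b) =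
    E1 :*r rcval (sphere_christoffel alpha a b 0)
    + E2 :*r rcval (sphere_christoffel alpha a b 1)
    + E3 :*r rcval (sphere_christoffel alpha a b 2)
    + E4 :*r rcval (sphere_christoffel alpha a b 3).
  rewrite -!christoffelE.
  transitivity (\sum_c Efr c :*r rcval (Gamma a b c)); last exact: sum4.
  exact: (frame_connectionE (D := D) Gamma xP lieP
    (fun c => (phiD c).1) (fun c => (phiD c).2)).
exists nabla; split.
- exact: calculus.
- by move=> nabla' calculus' d U; apply: (prc_unique calculus calculus').
- split.
  + by rewrite [LHS](nablaE 0 0) /= !ractNr.
  + split; [rewrite [LHS](nablaE 0 1)|rewrite [LHS](nablaE 1 0)].
      by rewrite /= !ract0 !addr0.
    by rewrite /= !ract0 !addr0.
  + split; [rewrite [LHS](nablaE 0 2)|rewrite [LHS](nablaE 2 0)].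
      by rewrite /= !ract0 !addr0.
    by rewrite /= !ract0 !addr0.
  + by rewrite [LHS](nablaE 0 3) /= !ract0 !addr0.
  + by rewrite [LHS](nablaE 3 0) /= !ract0 !addr0.
- split.
  + by rewrite [LHS](nablaE 1 1) /= !ractNr.
  + split; [rewrite [LHS](nablaE 1 2)|rewrite [LHS](nablaE 2 1)].
      by rewrite /= !ract0 add0r addr0.
    by rewrite /= !ract0 add0r addr0.
  + by rewrite [LHS](nablaE 1 3) /= !ract0 add0r addr0.
  + by rewrite [LHS](nablaE 3 1) /= !ract0 add0r addr0.
- split.
  + by rewrite [LHS](nablaE 2 2) /= !ractNr.
  + by rewrite [LHS](nablaE 2 3) /= !ract0 !add0r.
  + by rewrite [LHS](nablaE 3 2) /= !ract0 !add0r.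
  + by rewrite [LHS](nablaE 3 3) /= !ractNr.
  + move=> n a; have tn : rcval (rcT theta ^+ n) = Tl ^+ n by rewrite rmorphXn.
    have E0 (U : M4 theta) :
        U :*r Tl ^+ n = U :*r Tl ^+ 0 :*r rcval (rcT theta ^+ n).
      by rewrite expr0 ract1 tn.
    rewrite -tn; split; apply: (frame_connection_scaled Gamma xP).
    * exact: (pd1E dt1 dt2 dt3 dt4).
    * by rewrite !phi1 E0.
    * exact: (pd2E dt1 dt2 dt3 dt4).
    * by rewrite !phi2 E0.
    * exact: (pd3E dt1 dt2 dt3 dt4).
    * by rewrite !phi3 E0.
Qed.
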